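(* The map $F$ (defined in the context) induces an isomorphism of affine varieties $$\overline{T^*(\mathrm{SL}_3/U)}\;\xrightarrow{\ \sim\ }\;\overline{\mathcal{O}}_{\min},$$ where $\overline{\mathcal{O}}_{\min}$ is the closure of the minimal nilpotent orbit $\mathcal{O}_{\min}\subset\mathfrak{so}_8$. Here the left-hand side is identified with $N/\!\!/\mathrm{SL}_2$ and $\overline{\mathcal{O}}_{\min}$ is realized inside $\bigwedge^2\mathbb{C}^8=\mathfrak{so}_8$ as in the context; the induced map sends the class of $(\alpha,\beta)\in N$ to $F(\alpha,\beta)(e_1)\wedge F(\alpha,\beta)(e_2)$.
   Context: All varieties are over $\mathbb{C}$. Affine closure. $U\subset\mathrm{SL}_3(\mathbb{C})$ is the group of upper triangular unipotent matrices and $\overline{T^*(\mathrm{SL}_3/U)}:=\operatorname{Spec}\mathbb{C}[T^*(\mathrm{SL}_3/U)]$ (the ring is finitely generated). Quiver description. Let $V=\operatorname{Hom}(\mathbb{C},\mathbb{C}^2)\oplus\operatorname{Hom}(\mathbb{C}^2,\mathbb{C}^3)$ and identify (via the trace pairing) $T^*V$ with the space of tuples $(\alpha,\beta)=(\alpha_1,\alpha_2,\beta_1,\beta_2)$, $\alpha_k\in\operatorname{Hom}(\mathbb{C}^k,\mathbb{C}^{k+1})$, $\beta_k\in\operatorname{Hom}(\mathbb{C}^{k+1},\mathbb{C}^k)$. The group $\mathrm{SL}_2$ acts by $g\cdot(\alpha_1,\alpha_2,\beta_1,\beta_2)=(g\alpha_1,\alpha_2g^{-1},\beta_1g^{-1},g\beta_2)$.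 This action is Hamiltonian with moment map $\mu(\alpha,\beta)(X)=\operatorname{Tr}((\alpha_1\beta_1-\beta_2\alpha_2)X)$, $X\in\mathfrak{sl}_2$. Let $N=\mu^{-1}(0)$, i.e. the subvariety of $(\alpha,\beta)$ such that $\beta_2\alpha_2-\alpha_1\beta_1$ is a scalar matrix, and $N/\!\!/\mathrm{SL}_2:=\operatorname{Spec}\mathbb{C}[N]^{\mathrm{SL}_2}$. It is a theorem of Dancer–Kirwan–Swann that $\overline{T^*(\mathrm{SL}_3/U)}\cong N/\!\!/\mathrm{SL}_2$. Under this identification $T^*(\mathrm{SL}_3/U)$ is the image of $N_{\mathrm{inj}}=\{(\alpha,\beta)\in N:\alpha_1,\alpha_2\text{ injective}\}$, where $\mathrm{SL}_3/U$ is the quotient by $\mathrm{SL}_2$ of the set of $\alpha\in V$ with injective components ($gU$ corresponding to the class of $(\iota_1,g\iota_2)$ with $\iota_k:\mathbb{C}^k\to\mathbb{C}^{k+1}$ the standard inclusions). The map $F$. Let $e_1,e_2$ be the standard basis of $\mathbb{C}^2$. Write $\mathbb{C}^4=\mathbb{C}^3\oplus\mathbb{C}$, so $\alpha_2\oplus(-\beta_1):\mathbb{C}^2\to\mathbb{C}^4$ and $\beta_2\oplus\alpha_1:\mathbb{C}^4\to\mathbb{C}^2$. Define the linear isomorphism $$F:T^*V\to\operatorname{Hom}(\mathbb{C}^2,\mathbb{C}^4\oplus(\mathbb{C}^4)^* )=\operatorname{Hom}(\mathbb{C}^2,\mathbb{C}^8),\quad F(\alpha,\beta)(v)=(\alpha_2\oplus-\beta_1)(v)\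 \oplus\ \frac{(\beta_2\oplus\alpha_1)\wedge v}{e_1\wedge e_2},$$ where the second component is the functional $x\mapsto \big((\beta_2\oplus\alpha_1)(x)\wedge v\big)/(e_1\wedge e_2)$ on $\mathbb{C}^4$. Here $\mathbb{C}^4\oplus(\mathbb{C}^4)^*=\mathbb{C}^3\oplus\mathbb{C}\oplus\mathbb{C}^*\oplus(\mathbb{C}^3)^*$ is identified with $\mathbb{C}^8$ (with standard basis $e_1,\dots,e_8$) by $$\eta(z_1,z_2,z_3,a,b,w_1,w_2,w_3)=z_1e_2+z_2e_3-z_3e_8+ae_4+be_5-w_3e_1+w_2e_6+w_1e_7,$$ where $z$, $a$, $b$, $w$ are the coordinates on $\mathbb{C}^3$, $\mathbb{C}$, $\mathbb{C}^*$ (the dual of $\mathbb{C}$), $(\mathbb{C}^3)^*$ in the standard (dual) bases. The orbit. $\mathbb{C}^8$ carries the symmetric bilinear form $(e_i,e_j)=\delta_{i,9-j}$, $\mathfrak{so}_8$ is its orthogonal Lie algebra, identified with $\bigwedge^2\mathbb{C}^8$ by letting $v_1\wedge v_2$ act as $u\mapsto(v_1,u)v_2-(v_2,u)v_1$. $\mathcal{O}_{\min}$ is the unique nonzero nilpotent adjoint orbit of minimal dimension ($10$), and $\overline{\mathcal{O}}_{\min}=\mathcal{O}_{\min}\cup\{0\}$. *)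

(* Defs.v *)
From HB Require Import structures.
From mathcomp Require Import all_boot all_order all_algebra.
From mathcomp Require Import mpoly.
From mathcomp Require Import boolp reals.
From mathcomp.real_closed Require Import complex.

Set Implicit Arguments.
Unset Strict Implicit.
Unset Printing Implicit Defensive.

Import GRing.Theory.
Local Open Scope ring_scope.

(* A variety is given by its closed points together with its algebra of
   global regular functions.  Every variety below is affine, so that a
   morphism is exactly a map of points that pulls regular functions back to
   regular functions. *)
Record variety (K : fieldType) := Variety {
  points :> Type;
  regular : (points -> K) -> Prop
}.

Definition is_morphism (K : fieldType) (X Y : variety K) (phi : X -> Y) :=
  forall f : Y -> K, regular f -> regular (fun x => f (phi x)).

Definition is_isomorphism (K : fieldType) (X Y : variety K) (phi : X -> Y) :=
  is_morphism phi /\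
  exists psi : Y -> X, [/\ is_morphism psi, cancel phi psi & cancel psi phi].

Section Affine.
Variables (K : fieldType) (E : vectType K).

Definition polynomial_function (f : E -> K) :=
  exists p : {mpoly K[\dim {:E}]},
    forall x, f x = p.@[fun i => coord (vbasis {:E}) i x].

Definition zariski_closure (S : E -> Prop) : E -> Prop := fun x =>
  forall f : E -> K, polynomial_function f ->
    (forall y, S y -> f y = 0) -> f x = 0.

(* For a Zariski closed S. *)
Definition closed_subvariety (S : E -> Prop) : variety K :=
  @Variety K {x : E | S x}
    (fun f => exists2 p, polynomial_function p & forall x, f x = p (sval x)).

End Affine.

Section Spec.
Variables (K : fieldType) (T : Type) (A : (T -> K) -> Prop).

(* When A is a subalgebra of the K-algebra of all functions T -> K, these are
   the K-algebra morphisms A -> K. *)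
Definition is_character (chi : {f | A f} -> K) :=
  [/\ forall f g h, (forall t, sval h t = sval f t + sval g t) ->
        chi h = chi f + chi g,
      forall f g h, (forall t, sval h t = sval f t * sval g t) ->
        chi h = chi f * chi g
    & forall c f, (forall t, sval f t = c) -> chi f = c].

(* The closed points of Spec A are the K-algebra morphisms A -> K (K being
   algebraically closed and A finitely generated), on which the elements of A
   act by evaluation. *)
Definition Spec : variety K :=
  @Variety K {chi | is_character chi}
    (fun f => exists a : {a | A a}, forall chi, f chi = sval chi a).

Lemma evaluation_is_character (t : T) :
  is_character (fun f : {f | A f} => sval f t).
Proof. by split=> [f g h|f g h|c f]; apply. Qed.

Definition Spec_class (t : T) : Spec :=
  exist _ _ (evaluation_is_character t).

End Spec.

Section Quotient.
Variables (K : fieldType) (E : vectType K) (gT : Type).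
Variables (S : E -> Prop) (G : gT -> Prop) (act : gT -> E -> E).

(* K[S]^G, for G acting on the Zariski closed set S *)
Definition invariant_function (f : closed_subvariety S -> K) :=
  regular f /\
  forall g (x y : closed_subvariety S),
    G g -> sval y = act g (sval x) -> f y = f x.

Definition quotient : variety K := Spec invariant_function.

Definition quotient_class (x : closed_subvariety S) : quotient :=
  Spec_class invariant_function x.

End Quotient.

Section Quiver.
Variable K : fieldType.

(* (alpha_1, alpha_2, beta_1, beta_2) *)
Definition TstarV : vectType K :=
  ('M[K]_(2, 1) * 'M[K]_(3, 2) * 'M[K]_(1, 2) * 'M[K]_(2, 3))%type.

Definition alpha1 (x : TstarV) : 'M[K]_(2, 1) := x.1.1.1.
Definition alpha2 (x : TstarV) : 'M[K]_(3, 2) := x.1.1.2.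
Definition beta1 (x : TstarV) : 'M[K]_(1, 2) := x.1.2.
Definition beta2 (x : TstarV) : 'M[K]_(2, 3) := x.2.

Definition SL n (g : 'M[K]_n) : Prop := \det g = 1.

Definition SL2_act (g : 'M[K]_2) (x : TstarV) : TstarV :=
  (g *m alpha1 x, alpha2 x *m invmx g, beta1 x *m invmx g, g *m beta2 x).

Definition moment_map (x : TstarV) (X : 'M[K]_2) : K :=
  \tr ((alpha1 x *m beta1 x - beta2 x *m alpha2 x) *m X).

Definition Nset (x : TstarV) : Prop :=
  forall X : 'M[K]_2, \tr X = 0 -> moment_map x X = 0.

Definition Nvar : variety K := closed_subvariety Nset.

Definition N_mod_SL2 : variety K := quotient Nset (@SL 2) SL2_act.

Definition N_class (x : Nvar) : N_mod_SL2 :=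
  quotient_class (@SL 2) SL2_act x.

End Quiver.

(* T^*(SL_3/U) is the homogeneous bundle SL_3 x_U (sl_3/u)^*, where
   (sl_3/u)^* is the annihilator of u in sl_3 for the trace form: the class
   of (g, X) is the covector at gU sending the velocity at t = 0 of
   g exp(tY) U to tr(XY).  Its regular functions are the U-invariant regular
   functions on SL_3 x (sl_3/u)^*. *)
Section Cotangent.
Variable K : fieldType.

Definition Ugroup (u : 'M[K]_3) : Prop :=
  forall i j : 'I_3, (j <= i)%N -> u i j = (i == j)%:R.

Definition Ualgebra (Y : 'M[K]_3) : Prop :=
  forall i j : 'I_3, (j <= i)%N -> Y i j = 0.

Definition SL3_conormal (p : 'M[K]_3 * 'M[K]_3) : Prop :=
  [/\ SL p.1, \tr p.2 = 0 &
      forall Y : 'M[K]_3, Ualgebra Y -> \tr (p.2 *m Y) = 0].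

Definition U_act (u : 'M[K]_3) (p : 'M[K]_3 * 'M[K]_3) : 'M[K]_3 * 'M[K]_3 :=
  (p.1 *m invmx u, u *m p.2 *m invmx u).

Definition TstarSL3U_closure : variety K := quotient SL3_conormal Ugroup U_act.

Definition TstarSL3U_class (p : closed_subvariety SL3_conormal) :
  TstarSL3U_closure := quotient_class Ugroup U_act p.

(* gU is the class of (iota_1, g iota_2), and the covector at gU is the
   restriction of the covector (beta_1, beta_2) of V to the velocities
   (0, g Y iota_2). *)
Definition same_covector (p : 'M[K]_3 * 'M[K]_3) (x : TstarV K) : Prop :=
  [/\ alpha1 x = pid_mx 1, alpha2 x = p.1 *m pid_mx 2 &
      forall Y : 'M[K]_3, \tr Y = 0 ->
        \tr (p.2 *m Y) = \tr (beta2 x *m (p.1 *m Y *m pid_mx 2))].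

(* The isomorphism of Dancer, Kirwan and Swann. *)
Definition DKS_identification (j : TstarSL3U_closure -> N_mod_SL2 K) : Prop :=
  is_isomorphism j /\
  forall (p : closed_subvariety SL3_conormal) (x : Nvar K),
    same_covector (sval p) (sval x) -> j (TstarSL3U_class p) = N_class x.

End Cotangent.

Section MapF.
Variable K : fieldType.

(* e_1, ..., e_8: indices start at 1 *)
Definition e8 (k : nat) : 'cV[K]_8 := delta_mx (inord k.-1) 0.

Definition eta (z : 'cV[K]_3) (a b : K) (w : 'rV[K]_3) : 'cV[K]_8 :=
  let z1 := z 0 0 in let z2 := z 1 0 in let z3 := z 2 0 in
  let w1 := w 0 0 in let w2 := w 0 1 in let w3 := w 0 2 in
  z1 *: e8 2 + z2 *: e8 3 - z3 *: e8 8 + a *: e8 4 + b *: e8 5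
  - w3 *: e8 1 + w2 *: e8 6 + w1 *: e8 7.

(* (y, t) |-> ((beta_2 (+) alpha_1)(y, t) /\ v) / (e_1 /\ e_2) on C^3 (+) C *)
Definition Ffunctional (x : TstarV K) (v : 'cV[K]_2)
    (y : 'cV[K]_3) (t : 'cV[K]_1) : K :=
  \det (row_mx (beta2 x *m y + alpha1 x *m t) v : 'M[K]_2).

Definition F (x : TstarV K) (v : 'cV[K]_2) : 'cV[K]_8 :=
  eta (alpha2 x *m v) (- (beta1 x *m v) 0 0)
      (Ffunctional x v 0 1%:M)
      (\row_(i < 3) Ffunctional x v (delta_mx i 0) 0).

End MapF.

Section Orthogonal.
Variable K : fieldType.

Definition J8 : 'M[K]_8 := \matrix_(i, j) (i == rev_ord j)%:R.

Definition form8 (u v : 'cV[K]_8) : K := (u^T *m J8 *m v) 0 0.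

Definition so8 : {vspace 'M[K]_8} :=
  lker (linfun (mulmx J8 \+ (mulmxr J8 \o trmx))).

Lemma mem_so8 (X : 'M[K]_8) : (X \in so8) = (J8 *m X + X^T *m J8 == 0).
Proof. by rewrite memv_ker lfunE. Qed.

Lemma so8P (X : 'M[K]_8) :
  (forall u v, form8 (X *m u) v = - form8 u (X *m v)) <-> X \in so8.
Proof.
have sumE u v : form8 (X *m u) v + form8 u (X *m v) =
    (u^T *m (J8 *m X + X^T *m J8) *m v) 0 0.
  by rewrite /form8 trmx_mul mulmxDr mulmxDl !mulmxA [in RHS]mxE addrC.
rewrite mem_so8; split=> [h|/eqP h u v]; last first.
  by apply/eqP; rewrite -addr_eq0 sumE h mulmx0 mul0mx mxE.
apply/eqP/matrixP=> i j; have := sumE (delta_mx i 0) (delta_mx j 0).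
by rewrite h addNr trmx_delta -rowE -colE => E; rewrite [RHS]mxE E [RHS]mxE [RHS]mxE.
Qed.

Definition wedge (v1 v2 : 'cV[K]_8) : 'M[K]_8 :=
  v2 *m (v1^T *m J8) - v1 *m (v2^T *m J8).

Lemma wedgeE (v1 v2 u : 'cV[K]_8) :
  wedge v1 v2 *m u = form8 v1 u *: v2 - form8 v2 u *: v1.
Proof.
have sc (a b : 'cV[K]_8) : b *m (a^T *m J8) *m u = form8 a u *: b.
  by rewrite -mulmxA [_ *m u]mx11_scalar mul_mx_scalar.
by rewrite mulmxBl !sc.
Qed.

Definition SO8 (g : 'M[K]_8) : Prop := g^T *m J8 *m g = J8 /\ \det g = 1.

(* the orbits of SO_8 on so_8 are those of the adjoint group SO_8/{1,-1} *)
Definition adjoint_orbit (X Y : 'M[K]_8) : Prop :=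
  exists2 g, SO8 g & Y = g *m X *m invmx g.

Definition ad (X : 'M[K]_8) : 'End('M[K]_8) := linfun (mulmx X \- mulmxr X).

(* The dimension of the orbit of X, an (equidimensional) smooth variety whose
   tangent space at X is [so_8, X]. *)
Definition orbit_dim (X : 'M[K]_8) : nat := \dim (ad X @: so8).

Definition nonzero_nilpotent (X : 'M[K]_8) : Prop :=
  [/\ X \in so8, X != 0 & exists n, X ^+ n = 0].

Definition minimal_nilpotent_orbit (O : 'M[K]_8 -> Prop) : Prop :=
  exists X, [/\ nonzero_nilpotent X,
    forall Y, O Y <-> adjoint_orbit X Y &
    forall Y, nonzero_nilpotent Y -> (orbit_dim X <= orbit_dim Y)%N].

Lemma wedge_so8 (v1 v2 : 'cV[K]_8) : wedge v1 v2 \in so8.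
Proof.
apply/so8P => u v; rewrite !wedgeE.
have formC a b : form8 a b = form8 b a.
  rewrite /form8 -[in LHS](trmxK (a^T *m J8 *m b)) mxE !trmx_mul trmxK mulmxA.
  congr ((_ *m _ *m _) 0 0); apply/matrixP=> i j; rewrite !mxE.
  by rewrite -(inj_eq rev_ord_inj) rev_ordK eq_sym.
have formB a b c d w :
    form8 w (a *: b - c *: d) = a * form8 w b - c * form8 w d.
  by rewrite /form8 mulmxBr -!scalemxAr !mxE.
rewrite formC !formB (formC v v1) (formC v v2) (formC u v1) (formC u v2).
by rewrite opprB ![form8 v1 u * _]mulrC ![form8 v2 u * _]mulrC.
Qed.

Lemma exists_minimal_nilpotent_orbit :
  exists O : 'M[K]_8 -> Prop, minimal_nilpotent_orbit O.
Proof.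
pose X0 := wedge (e8 K 1) (e8 K 2).
have fe k l : (0 < k <= 8)%N -> (0 < l <= 8)%N ->
    form8 (e8 K k) (e8 K l) = (k + l == 9)%:R.
  move=> /andP[k0 k8] /andP[l0 l8].
  rewrite /form8 /e8 trmx_delta -rowE -colE !mxE -val_eqE /= !inordK ?prednK //.
  rewrite ?prednK //; case: k k0 k8 => //= k _ _.
  by rewrite -(eqn_add2r l) subnK // addSn eqSS.
have X0nz : nonzero_nilpotent X0.
  split; first exact: wedge_so8.
    apply/eqP => /(congr1 (fun A => (A *m e8 K 8) (inord 1) 0)).
    rewrite wedgeE !fe //= scale1r scale0r subr0 mul0mx /e8 !mxE eqxx /=.
    by rewrite eqxx => /eqP; rewrite oner_eq0.
  exists 2; rewrite expr2 -[X0 * X0]/(X0 *m (e8 K 2 *m _ - e8 K 1 *m _)).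
  by rewrite mulmxBr !(mulmxA X0) !wedgeE !fe // !scale0r subrr !mul0mx subrr.
have [n] : exists n, orbit_dim X0 = n by exists (orbit_dim X0).
elim/ltn_ind: n X0 X0nz => n IH X Xnz Xn.
have [[Y [Ynz lt]]|min] := boolp.EM (exists Y, nonzero_nilpotent Y /\ (orbit_dim Y < n)%N).
  exact: IH lt Y Ynz erefl.
exists (adjoint_orbit X), X; split=> // Y Ynz; rewrite Xn leqNgt.
by apply/negP => lt; apply: min; exists Y.
Qed.

End Orthogonal.

(* Main.v *)
(* F identifies T^*V with the 8 x 2 matrices A, the zero fibre N with those whose
   columns span an isotropic subspace, and the action of SL_2 with right
   multiplication, so that the induced map is A |-> a /\ b for the columns a, b.

   Functions: an SL_2-invariant function on a cone S stable under SL_2 is a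
   polynomial in the 2 x 2 minors.  Its homogeneous parts are invariant on S, and
   so is the weight-0 part of each; the extremal projector of sl_2 changes it by
   functions vanishing on S into a polynomial which is really invariant.  For the
   latter, Capelli's identity expresses p(p+1) f as a combination of minors times
   invariants of lower degree.

   Points: the minimal orbit consists of the nonzero isotropic wedges.  Indeed, if
   (X v, w) <> 0 for isotropic orthogonal basis vectors v, w and [X, so_8] has
   dimension at most 10, then X kills the orthogonal of X v and X w, hence X is
   proportional to X v /\ X w, whose Gram matrix vanishes when X is nilpotent.
   All isotropic wedges are conjugate by Witt's theorem, and together with 0 they
   are cut out by the Pluecker relations and Y^2 = 0. *)

Require Import Defs.
From HB Require Import structures.
From mathcomp Require Import all_boot all_order all_algebra.
From mathcomp Require Import perm mpoly ring zify.
From mathcomp Require Import boolp reals.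
From mathcomp.real_closed Require Import complex.

Set Implicit Arguments.
Unset Strict Implicit.
Unset Printing Implicit Defensive.

Import GRing.Theory Num.Theory.
Local Open Scope ring_scope.

(** * Polynomial functions *)

(** A function on N is represented by a polynomial that need not be invariant off N, and the ideal
    of N is never computed. The mixed polarizations preserve that ideal, so the correction is made
    by differential operators alone: every term of the projector after the first arises from E h by
    such operators, and E h vanishes on N. The number 10 enters as 1 + 4 + 4 + 1, the rank of a
    triangular system of functionals on the image of ad X attached to the plane of v and w. A
    bracket killed by all of them must vanish, and this rigidity takes the place of the
    classification of nilpotent orbits. Coordinate planes suffice: if X pairs all of them to zero,
    it is diagonal. A closed point of the quotient is a character, not an orbit. Its image is read
    off from its values on the 64 entries of the wedge, and satisfies the equations of the closure
    formally, before any orbit representing the character is known. *)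

Lemma mpoly_ring_ind N (K : nzRingType) (P : {mpoly K[N]} -> Prop) :
  (forall c, P c%:MP) -> (forall i, P 'X_i) ->
  (forall p q, P p -> P q -> P (p + q)) -> (forall p q, P p -> P q -> P (p * q)) ->
  forall p, P p.
Proof.
move=> PC PX PD PM; elim/mpolyind => [|c m p _ _ Pp].
  by rewrite -(mpolyC0 N); exact: PC.
apply: PD => //; rewrite -mul_mpolyC; apply: (PM); first exact: PC.
rewrite mpolyXE_id; apply: big_ind => [|x x' Px Px'|i _].
- by rewrite -mpolyC1; exact: PC.
- exact: PM.
- elim: (m i) => [|k IH]; first by rewrite expr0 -mpolyC1; exact: PC.
  by rewrite exprS; exact: PM.
Qed.

Section PolynomialFunctions.
Variables (K : fieldType) (E : vectType K).

Lemma polynomial_function_ext (f g : E -> K) :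
  f =1 g -> polynomial_function f -> polynomial_function g.
Proof. by move=> fg [p pf]; exists p => x; rewrite -fg. Qed.

Lemma polynomial_function_const c : polynomial_function (fun _ : E => c).
Proof. by exists c%:MP => x; rewrite mevalC. Qed.

Lemma polynomial_functionD (f g : E -> K) : polynomial_function f ->
  polynomial_function g -> polynomial_function (fun x => f x + g x).
Proof. by move=> [p pf] [q qg]; exists (p + q) => x; rewrite mevalD pf qg. Qed.

Lemma polynomial_functionM (f g : E -> K) : polynomial_function f ->
  polynomial_function g -> polynomial_function (fun x => f x * g x).
Proof. by move=> [p pf] [q qg]; exists (p * q) => x; rewrite mevalM pf qg. Qed.

Lemma polynomial_functionB (f g : E -> K) : polynomial_function f ->
  polynomial_function g -> polynomial_function (fun x => f x - g x).
Proof. by move=> [p pf] [q qg]; exists (p - q) => x; rewrite mevalB pf qg. Qed.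

Lemma polynomial_function_sum (I : Type) (r : seq I) (f : I -> E -> K) :
  (forall i, polynomial_function (f i)) ->
  polynomial_function (fun x => \sum_(i <- r) f i x).
Proof.
move=> pf; elim: r => [|i r IH].
  by apply: polynomial_function_ext (polynomial_function_const 0) => x; rewrite big_nil.
apply: polynomial_function_ext (polynomial_functionD (pf i) IH) => x.
by rewrite big_cons.
Qed.

Lemma linear_polynomial_function (f : {linear E -> K^o}) : polynomial_function f.
Proof.
exists (\sum_(i < \dim {:E}) f (vbasis {:E})`_i *: 'X_i) => x.
rewrite [in LHS](coord_vbasis (memvf x)) !linear_sum /=.
by apply: eq_bigr => i _; rewrite linearZ mevalZ mevalXU mulrC.
Qed.

Lemma meval_polynomial_function N (p : {mpoly K[N]}) (g : 'I_N -> E -> K) :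
  (forall i, polynomial_function (g i)) ->
  polynomial_function (fun x => p.@[fun i => g i x]).
Proof.
move=> pg; elim/mpoly_ring_ind: p => [c|i|p q Pp Pq|p q Pp Pq].
- apply: polynomial_function_ext (polynomial_function_const c) => x.
  by rewrite mevalC.
- by apply: polynomial_function_ext (pg i) => x; rewrite mevalXU.
- by apply: polynomial_function_ext (polynomial_functionD Pp Pq) => x; rewrite mevalD.
- by apply: polynomial_function_ext (polynomial_functionM Pp Pq) => x; rewrite mevalM.
Qed.

End PolynomialFunctions.

Lemma polynomial_function_comp (K : fieldType) (E E' : vectType K)
  (h : {linear E -> E'}) (f : E' -> K) :
  polynomial_function f -> polynomial_function (fun x => f (h x)).
Proof.
move=> [p pf].
have ph i : polynomial_function (fun x => coord (vbasis {:E'}) i (h x)).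
  pose c : E -> K^o := coord (vbasis {:E'}) i \o h.
  have lc : linear c by move=> a u v; rewrite /c /= !linearP.
  pose C := GRing.isLinear.Build K E K^o _ c lc.
  pose c' : {linear E -> K^o} := HB.pack c C.
  exact: (linear_polynomial_function c').
by apply: polynomial_function_ext (meval_polynomial_function p ph) => x.
Qed.

Lemma polynomial_function_entry (K : fieldType) m n (i : 'I_m) (j : 'I_n) :
  polynomial_function (fun A : 'M[K]_(m, n) => A i j).
Proof.
pose c (A : 'M[K]_(m, n)) : K^o := A i j.
have lc : linear c by move=> a u v; rewrite /c !mxE.
pose C := GRing.isLinear.Build K _ K^o _ c lc.
pose c' : {linear 'M[K]_(m, n) -> K^o} := HB.pack c C.
exact: (linear_polynomial_function c').
Qed.

(** Polynomial functions are defined through the basis [vbasis], whose vectors are not explicit. Its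
    coordinates are linear forms in any concrete ones, so substitution gives a polynomial in the
    latter. *)
Lemma polynomial_function_coords (K : fieldType) (E : vectType K) N
  (x_ : E -> 'I_N -> K) (b : 'I_N -> E) (f : E -> K) :
  (forall x, x = \sum_k x_ x k *: b k) -> polynomial_function f ->
  exists q : {mpoly K[N]}, forall x, f x = q.@[x_ x].
Proof.
move=> xE [p pf].
pose l i : {mpoly K[N]} := \sum_k coord (vbasis {:E}) i (b k) *: 'X_k.
exists (p \mPo [tuple l i | i < \dim {:E}]) => x.
rewrite comp_mpoly_meval pf; apply: meval_eq => i.
rewrite tnth_mktuple /l raddf_sum {1}(xE x) linear_sum /=.
by apply: eq_bigr => k _; rewrite linearZ mevalZ mevalXU mulrC.
Qed.

(** * Weighted components and restriction to lines *)

Section Polynomials.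
Variable K : numFieldType.

(** Characteristic zero supplies infinitely many test values; leaving out 0 makes them invertible,
    so that they also serve as scalings and torus parameters. *)
Lemma poly_eq0_nat (p : {poly K}) : (forall n, p.[n.+1%:R] = 0) -> p = 0.
Proof.
move=> p0; apply/eqP/negPn/negP => pn0.
pose rs : seq K := [seq n.+1%:R | n <- iota 0 (size p)].
have /(max_poly_roots pn0) : all (root p) rs.
  by apply/allP => _ /mapP[n _ ->]; apply/rootP.
rewrite map_inj_uniq ?iota_uniq => [/(_ isT)|a b /eqP].
  by rewrite size_map size_iota ltnn.
by rewrite eqr_nat => /eqP[].
Qed.

Variable N : nat.
Implicit Types (f g : {mpoly K[N]}) (y z : 'I_N -> K) (w : 'I_N -> nat).

Definition wdeg w (m : 'X_{1..N}) : nat := (\sum_i w i * m i)%N.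

Definition wcomp w k f : {mpoly K[N]} :=
  \sum_(m <- msupp f | wdeg w m == k) f@_m *: 'X_[m].

(** The values of [f] along the weighted orbit of [y], as a polynomial in the parameter: an identity
    valid for all parameters passes to the weighted components, which are its coefficients. *)
Definition wpoly w f y : {poly K} :=
  \sum_(m <- msupp f) (f@_m * \prod_i y i ^+ m i) *: 'X^(wdeg w m).

Lemma mcoeff_wcomp w k f m :
  (wcomp w k f)@_m = if wdeg w m == k then f@_m else 0.
Proof.
rewrite /wcomp linear_sum /=.
under eq_bigr => m' _ do rewrite mcoeffZ mcoeffX.
have [mf|mf] := boolP (m \in msupp f).
  rewrite (big_rem m) //= big1_seq ?addr0.
    by rewrite eqxx mulr1.
  move=> m' /andP[_]; have := msupp_uniq f; rewrite (perm_uniq (perm_to_rem mf)).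
  case/andP=> mn _ m'r.
 case: (m' =P m) => [e|_]; first by rewrite e (negbTE mn) in m'r.
 by rewrite mulr0.
rewrite big1_seq => [|m' /andP[_ m'f]].
  by rewrite (memN_msupp_eq0 mf) if_same.
case: eqP => [e|]; rewrite ?mulr0 //.
by rewrite -e m'f in mf.
Qed.

Lemma horner_wpoly w f y s :
  (wpoly w f y).[s] = f.@[fun i => s ^+ w i * y i].
Proof.
rewrite /wpoly horner_sum mevalE /=; apply: eq_bigr => m _.
rewrite !hornerE -mulrA; congr (_ * _); rewrite mulrC /wdeg -prodrXr -big_split /=.
by apply: eq_bigr => i _; rewrite exprMn exprM.
Qed.

Lemma coef_wpoly w f y k : (wpoly w f y)`_k = (wcomp w k f).@[y].
Proof.
rewrite /wpoly /wcomp coef_sum raddf_sum /= [RHS]big_mkcond /=.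
apply: eq_bigr => m _; rewrite coefZ coefXn eq_sym.
by case: eqP => _; rewrite ?mulr0 ?mulr1 // mevalZ mevalX.
Qed.

Definition line_poly f y z : {poly K} :=
  mmap (@polyC K) (fun i => (y i)%:P + z i *: 'X) f.

Lemma horner_line f y z t : (line_poly f y z).[t] = f.@[fun i => y i + t * z i].
Proof.
rewrite /line_poly /mmap horner_sum mevalE; apply: eq_bigr => m _.
rewrite hornerM hornerC; congr (_ * _); rewrite /mmap1 horner_prod.
by apply: eq_bigr => i _; rewrite !hornerE [z i * t]mulrC.
Qed.

(** First-order Taylor expansion. The two coefficients are treated together because the product rule
    for the linear one involves the constant one. *)
Lemma line_coef01 f y z : (line_poly f y z)`_0 = f.@[y] /\
  (line_poly f y z)`_1 = \sum_i z i * f^`M(i).@[y].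
Proof.
pose P f := (line_poly f y z)`_0 = f.@[y] /\
  (line_poly f y z)`_1 = \sum_i z i * f^`M(i).@[y].
rewrite -[_ /\ _]/(P f).
have PM p q : P p -> P q -> P (p * q).
  rewrite /P /line_poly => -[p0 p1] [q0 q1].
  rewrite rmorphM /= !coefM big_ord1 !big_ord_recr big_ord0 /= p0 q0 p1 q1.
  split; first by rewrite mevalM.
  rewrite add0r big_distrr big_distrl -big_split /=; apply: eq_bigr => i _.
  by rewrite mderivM mevalD !mevalM; ring.
have PC c : P c%:MP.
  rewrite /P /line_poly mmapC !coefC mevalC; split=> //=.
  by rewrite big1 // => i _; rewrite mderivC meval0 mulr0.
have PD p q : P p -> P q -> P (p + q).
  rewrite /P /line_poly => -[p0 p1] [q0 q1].
  rewrite rmorphD /= !coefD p0 p1 q0 q1 mevalD; split=> //.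
  rewrite -big_split /=; apply: eq_bigr => i _.
  by rewrite mderivD mevalD mulrDr.
have PX i : P 'X_i.
  rewrite /P /line_poly mmapX mmap1U mevalXU !coefD !coefC !coefZ !coefX /=.
  split; first by rewrite mulr0 addr0.
  rewrite (bigD1 i) //= big1 ?addr0 => [|j ji]; last first.
    by rewrite mderivX mnm1E eq_sym (negbTE ji) scale0r meval0 mulr0.
  by rewrite mderivX mnm1E eqxx scale1r mevalX big1 ?add0r ?mulr1 // => j _; rewrite mnmBE subnn.
exact: mpoly_ring_ind.
Qed.

End Polynomials.

(** * Invariants of SL_2 *)

Section SL2Triple.
Variables (K : numFieldType) (V : lmodType K) (E F H : {linear V -> V}).
Hypothesis EF : forall v, E (F v) = F (E v) + H v.
Hypothesis HE : forall v, H (E v) = E (H v) + 2 *: E v.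
Hypothesis HF : forall v, H (F v) = F (H v) - 2 *: F v.

Lemma sl2_wt_iterF w v k : H v = w *: v ->
  H (iter k F v) = (w - 2 * k%:R) *: iter k F v.
Proof.
move=> Hv; elim: k => [|k IH]; first by rewrite mulr0 subr0.
by rewrite iterS HF IH linearZ -scalerBl; congr (_ *: _); rewrite mulrS; ring.
Qed.

(** Moving E past each F produces H, which acts by the weight reached so far; the sum of these
    weights is k (w - k + 1). At k = 0 this factor is 0, so the truncated predecessor is
    harmless. *)
Lemma sl2_E_iterF w v k : H v = w *: v ->
  E (iter k F v) = iter k F (E v) + (k%:R * (w - k%:R + 1)) *: iter k.-1 F v.
Proof.
move=> Hv; have Hk j := sl2_wt_iterF j Hv.
elim: k => [|k IH]; first by rewrite mul0r scale0r addr0.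
rewrite iterS EF IH linearD linearZ /= Hk -addrA; congr (_ + _).
case: k {IH} => [|k] /=.
  by rewrite mul0r scale0r add0r; congr (_ *: _); ring.
by rewrite -scalerDl; congr (_ *: _); rewrite !mulrS; ring.
Qed.

Lemma sl2_wt_iterE w v k : H v = w *: v ->
  H (iter k E v) = (w + 2 * k%:R) *: iter k E v.
Proof.
move=> Hv; elim: k => [|k IH]; first by rewrite mulr0 addr0.
by rewrite iterS HE IH linearZ -scalerDl; congr (_ *: _); rewrite mulrS; ring.
Qed.

(* The extremal projector of sl_2, in weight 0. *)
Definition sl2_proj d v : V :=
  \sum_(k < d) ((-1) ^+ k / (k`! * k.+1`!)%:R) *: iter k F (iter k E v).

Lemma sl2_projS d v : sl2_proj d.+1 v = sl2_proj d v +
  ((-1) ^+ d / (d`! * d.+1`!)%:R) *: iter d F (iter d E v).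
Proof. exact: big_ord_recr. Qed.

(** Telescoping: E^k v has weight 2k, so applying E to the k-th term leaves k (k + 1) F^(k-1) E^k v
    besides F^k E^(k+1) v, and the factorials are chosen so that the former cancels the remainder of
    the previous term. *)
Lemma sl2_proj_E d v : H v = 0 -> E (sl2_proj d.+1 v) =
  ((-1) ^+ d / (d`! * d.+1`!)%:R) *: iter d F (iter d.+1 E v).
Proof.
move=> Hv; have Hv0 : H v = 0 *: v by rewrite scale0r.
elim: d => [|d IH]; rewrite sl2_projS linearD linearZ_LR.
  by rewrite /sl2_proj big_ord0 linear0 add0r.
rewrite IH (sl2_E_iterF _ (sl2_wt_iterE d.+1 Hv0)) scalerDr addrCA.
rewrite scalerA -scalerDl -[RHS]addr0; congr (_ + _).
rewrite [X in X *: _](_ : _ = 0) ?scale0r //.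
rewrite (factS d.+1) [in X in _ + X](factS d) exprS !natrM.
have f0 j : (j`!)%:R != 0 :> K by rewrite pnatr_eq0 -lt0n fact_gt0.
rewrite -!natr1; field.
by rewrite f0 !natr1 !pnatr_eq0.
Qed.

End SL2Triple.

(** * Polarization operators and Capelli's identity *)

Section Polarization.
Variables (K : numFieldType) (n : nat).
Implicit Types (f : {mpoly K[n + n]}) (u v s t : bool) (i j : 'I_n).

(* Variable [pvar false i] (resp. [pvar true i]) is the [i]-th coordinate of the
   first (resp. second) vector. *)
Definition pvar u i : 'I_(n + n) := if u then rshift n i else lshift n i.

Lemma pvar_eq u v i j : (pvar u i == pvar v j) = (u == v) && (i == j).
Proof.
case: u v => [] [] /=; rewrite -val_eqE /= ?eqn_add2l //.
  by apply/negbTE; rewrite neq_ltn; apply/orP; right; rewrite ltn_addr.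
by apply/negbTE; rewrite neq_ltn; apply/orP; left; rewrite ltn_addr.
Qed.

(** The matrix unit (u, v) of gl_2, acting on polynomials in two vectors by differential
    operators. *)
Definition polarize u v f : {mpoly K[n + n]} :=
  \sum_i 'X_(pvar u i) * f^`M(pvar v i).

Lemma polarize_is_linear u v : linear (polarize u v).
Proof.
move=> a f g; rewrite /polarize scaler_sumr -big_split /=; apply: eq_bigr => i _.
by rewrite mderivD mderivZ mulrDr scalerAr.
Qed.

HB.instance Definition _ u v :=
  GRing.isLinear.Build K {mpoly K[n + n]} {mpoly K[n + n]} _ (polarize u v)
    (polarize_is_linear u v).

Lemma mderiv_pvar u v i j :
  ('X_(pvar u i) : {mpoly K[n + n]})^`M(pvar v j) = ((u == v) && (i == j))%:R.
Proof.
rewrite mderivX mnm1E pvar_eq; case: andP => [[/eqP -> /eqP ->]|_].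
  by rewrite scale1r -mpolyC1; apply/mpolyP => m; rewrite mcoeffX mcoeffC mul1r eq_sym;
     congr (_ == _)%:R; apply/mnmP => k; rewrite mnmBE subnn mnm0E.
by rewrite scale0r.
Qed.

Lemma polarize_mderiv u v t j f : polarize u v (f^`M(pvar t j)) =
  (polarize u v f)^`M(pvar t j) - (u == t)%:R *: f^`M(pvar v j).
Proof.
rewrite /polarize raddf_sum /=.
under [in RHS]eq_bigr => i _ do
  rewrite mderivM mderiv_pvar (mderiv_comm (pvar v i)).
rewrite big_split /= [X in _ = X + _ - _](_ : _ = (u == t)%:R *: f^`M(pvar v j)).
  by rewrite addrAC subrr add0r.
rewrite (bigD1 j) //= eqxx andbT big1 => [|i ij]; last first.
  by rewrite (negbTE ij) andbF mul0r.
by rewrite addr0 -scaler_nat -scalerAl mul1r.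
Qed.

(** Normal ordering: the second-order part is symmetric under exchange of the two operators, so
    commutators are of first order. *)
Lemma polarize_polarize u v s t f : polarize u v (polarize s t f) =
  (v == s)%:R *: polarize u t f +
  \sum_i \sum_j 'X_(pvar u i) * 'X_(pvar s j) * f^`M(pvar v i)^`M(pvar t j).
Proof.
rewrite [LHS]/polarize [polarize u t f]/polarize scaler_sumr -big_split /=.
apply: eq_bigr => i _.
rewrite [polarize s t f]/polarize raddf_sum /=.
under eq_bigr => j _ do rewrite mderivM mderiv_pvar (mderiv_comm (pvar t j)).
rewrite big_split /= mulrDr; congr (_ + _).
  rewrite (bigD1 i) //= eq_sym eqxx andbT big1 => [|j ij]; last first.
    by rewrite (negbTE ij) andbF mul0r.
  by rewrite addr0 -scaler_nat -scalerAl mul1r scalerAr.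
by rewrite mulr_sumr; apply: eq_bigr => j _; rewrite mulrA.
Qed.

Lemma polarize_comm u v s t f : polarize u v (polarize s t f) =
  polarize s t (polarize u v f) +
  ((v == s)%:R *: polarize u t f - (t == u)%:R *: polarize s v f).
Proof.
rewrite !polarize_polarize [in RHS]addrC addrA subrK; congr (_ + _).
rewrite exchange_big; apply: eq_bigr => i _; apply: eq_bigr => j _.
by rewrite (mderiv_comm (pvar t i)) (mulrC 'X_(pvar s i)).
Qed.

Lemma mcoeff_polarize u f m :
  (polarize u u f)@_m = (\sum_i m (pvar u i))%:R * f@_m.
Proof.
rewrite /polarize raddf_sum natr_sum mulr_suml /=; apply: eq_bigr => i _.
elim/mpolyind: f => [|c m' p _ _ Pp].
  by rewrite mderiv0 mulr0 !mcoeff0 mulr0.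
rewrite mderivD mderivZ mulrDr !mcoeffD {}Pp mulrDr; congr (_ + _).
rewrite -scalerAr !mcoeffZ mcoeffX mulrCA; congr (_ * _).
rewrite mderivX -scalerAr -mpolyXD mcoeffZ mcoeffX.
(* If the exponent is 0, the difference of multi-indices is truncated, but its coefficient is 0. *)
have [m0|m0] := posnP (m' (pvar u i)).
  by rewrite m0 mul0r; case: eqP => [<-|]; rewrite ?mulr0 // m0 mul0r.
rewrite addmC submK; last by apply/mnm_lepP => k; rewrite mnm1E; case: eqP => [<-|].
by case: eqP => [->|]; rewrite ?mulr0.
Qed.

Definition cayley i j f : {mpoly K[n + n]} :=
  f^`M(pvar false i)^`M(pvar true j) - f^`M(pvar false j)^`M(pvar true i).

(** A 2 x 2 determinant of derivatives transforms under gl_2 by minus the trace. It therefore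
    commutes with sl_2 and maps invariants to invariants of degree lower by two. *)
Lemma polarize_cayley u v i j f : polarize u v (cayley i j f) =
  cayley i j (polarize u v f) - (u == v)%:R *: cayley i j f.
Proof.
have pB g h : polarize u v (g - h) = polarize u v g - polarize u v h.
  exact: linearB.
rewrite /cayley pB !polarize_mderiv !mderivB !mderivZ.
have cl := mderiv_comm (lshift n i) (lshift n j) f.
have cr := mderiv_comm (rshift n i) (rshift n j) f.
by case: u v {pB} => [] [] /=; rewrite ?scale0r ?scale1r ?cl ?cr; ring.
Qed.

Definition xminor i j : {mpoly K[n + n]} :=
  'X_(pvar false i) * 'X_(pvar true j) - 'X_(pvar false j) * 'X_(pvar true i).

(** The first-order term offsets the normal ordering of the two mixed polarizations; the factor 2
    appears because the sum runs over ordered pairs of indices. *)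
Lemma capelli f : 2 *: (polarize false false (polarize true true f) +
    polarize false false f - polarize false true (polarize true false f)) =
  \sum_i \sum_j xminor i j * cayley i j f.
Proof.
rewrite !polarize_polarize /= !scale0r !scale1r !add0r opprD addrA addrK.
rewrite scaler_nat mulr2n.
pose D i j := f^`M(pvar false i)^`M(pvar true j).
pose x u i : {mpoly K[n + n]} := 'X_(pvar u i).
under [X in _ - X]eq_bigr => i _ do under eq_bigr => j _ do rewrite (mderiv_comm (pvar true i)).
rewrite -/x -/D.
rewrite [X in _ - X]exchange_big /= -sumrB.
have -> : \sum_i (\sum_j x false i * x true j * D i j -
    \sum_j x false j * x true i * D i j) = \sum_i \sum_j xminor i j * D i j.
  apply: eq_bigr => i _; rewrite -sumrB; apply: eq_bigr => j _.
  by rewrite /xminor mulrBl.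
rewrite [X in _ + X]exchange_big -big_split /=; apply: eq_bigr => i _.
rewrite -big_split /=; apply: eq_bigr => j _.
by rewrite /cayley -/(D i j) -/(D j i) /xminor; ring.
Qed.

End Polarization.

(** * First fundamental theorem for SL_2 *)

Section FirstFundamentalTheorem.
Variables (K : numFieldType) (n : nat).
Implicit Types (f : {mpoly K[n + n]}) (u v : bool) (A : 'M[K]_(n, 2)).

Definition idx u : 'I_2 := if u then 1 else 0.

Definition coords A (k : 'I_(n + n)) : K :=
  match split k with inl i => A i 0 | inr i => A i 1 end.

Lemma coords_pvar A u i : coords A (pvar u i) = A i (idx u).
Proof.
by case: u; rewrite /coords /pvar ?(unsplitK (inl i)) ?(unsplitK (inr i)).
Qed.

Lemma coordsZ A c k : coords (c *: A) k = c * coords A k.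
Proof. by rewrite /coords; case: split => i; rewrite mxE. Qed.

Definition minors A : 'M[K]_n :=
  \matrix_(i, j) (A i 0 * A j 1 - A j 0 * A i 1).

Definition minor_function f := exists2 P : 'M[K]_n -> K,
  polynomial_function P & forall A, f.@[coords A] = P (minors A).

Lemma minor_function_sum (I : Type) (r : seq I) (F : I -> {mpoly K[n + n]}) :
  (forall i, minor_function (F i)) -> minor_function (\sum_(i <- r) F i).
Proof.
move=> FP; elim: r => [|i r [P Pp Pe]].
  exists (fun=> 0); first exact: polynomial_function_const.
  by move=> A; rewrite big_nil meval0.
have [Q Qp Qe] := FP i.
exists (fun x : 'M[K]_n => Q x + P x); first exact: polynomial_functionD.
by move=> A; rewrite big_cons mevalD Qe Pe.
Qed.

Lemma minor_function_xminor i j f :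
  minor_function f -> minor_function (xminor K i j * f).
Proof.
move=> [P Pp Pe]; exists (fun x : 'M[K]_n => x i j * P x).
  by apply: polynomial_functionM => //; exact: polynomial_function_entry.
move=> A; rewrite mevalM Pe; congr (_ * _).
by rewrite /xminor mevalB !mevalM !mevalXU !coords_pvar mxE.
Qed.

Lemma minor_functionZ c f : minor_function f -> minor_function (c *: f).
Proof.
move=> [P Pp Pe]; exists (fun x : 'M[K]_n => c * P x).
  by apply: polynomial_functionM => //; exact: polynomial_function_const.
by move=> A; rewrite mevalZ Pe.
Qed.

Lemma dhomog_mderiv d i f : f \is d.-homog -> f^`M(i) \is d.-1.-homog.
Proof.
move=> /dhomogP fd; apply/dhomogP => m; rewrite mcoeff_msupp mcoeff_deriv => fm.
have /fd : (m + U_(i))%MM \in msupp f.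
  by rewrite mcoeff_msupp; apply: contraNneq fm => ->; rewrite mul0rn.
by rewrite /= mdegD mdeg1 addn1 => <-.
Qed.

Lemma dhomog_polarize d u v f : f \is d.-homog -> polarize u v f \is d.-homog.
Proof.
move=> fd; rewrite /polarize rpred_sum // => i _.
(* Degree 0 is separate: the truncated predecessor followed by a variable would give degree 1, but
   there the derivative is zero. *)
case: d fd => [|d] fd; last first.
  rewrite -add1n; apply: dhomogM; last exact: (dhomog_mderiv _ fd).
  by rewrite dhomogX /= mdeg1.
suff -> : f^`M(pvar v i) = 0 by rewrite mulr0 rpred0.
apply/mpolyP => m; rewrite mcoeff_deriv mcoeff0 (dhomog_nemf_coeff fd) ?mul0rn //.
by rewrite /= mdegD mdeg1 addn1.
Qed.

Lemma polarize_degree d f : f \is d.-homog ->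
  polarize false false f + polarize true true f = d%:R *: f.
Proof.
move=> fd; apply/mpolyP => m; rewrite mcoeffD !mcoeff_polarize mcoeffZ -mulrDl -natrD.
have [->|fm] := eqVneq f@_m 0; first by rewrite !mulr0.
congr (_%:R * _); have <- : mdeg m = d.
  by have /dhomogP := fd; apply; rewrite mcoeff_msupp.
by rewrite mdegE big_split_ord.
Qed.

(** Highest weight vectors of weight 0 are handled by induction on the degree: Capelli's identity,
    whose mixed term disappears, writes a nonzero multiple of [f] through minors and the lower
    invariants [cayley i j f]. *)
Lemma fft_homog d f : f \is d.-homog -> polarize true false f = 0 ->
  polarize true true f = polarize false false f -> minor_function f.
Proof.
elim/ltn_ind: d f => -[|d] IH f fd Ef Hf.
  have -> : f = (f@_0%MM)%:MP.
    apply/mpolyP => m; rewrite mcoeffC; case: eqP => [->|m0]; first by rewrite mulr1.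
    rewrite mulr0 (dhomog_nemf_coeff fd) //=.
    by rewrite mdeg_eq0; apply/eqP.
  exists (fun=> f@_0%MM); first exact: polynomial_function_const.
  by move=> A; rewrite mevalC.
(* Weight 0 forces equal degrees in the two vectors, hence half of the total degree each. *)
have E0 : polarize false false f = (d.+1%:R / 2) *: f.
  have h : d.+1%:R *: f = 2 *: polarize false false f.
    by rewrite -(polarize_degree fd) Hf scaler_nat mulr2n.
  by rewrite mulrC -scalerA h scalerA mulVf ?scale1r // pnatr_eq0.
have c0 : 2 * ((d.+1%:R / 2) ^+ 2 + d.+1%:R / 2) != 0 :> K.
  by rewrite lt0r_neq0 // mulr_gt0 // addr_gt0 ?exprn_gt0 ?divr_gt0 ?ltr0n.
suff : minor_function ((2 * ((d.+1%:R / 2) ^+ 2 + d.+1%:R / 2)) *: f).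
  move=> /(minor_functionZ (2 * ((d.+1%:R / 2) ^+ 2 + d.+1%:R / 2))^-1).
  by rewrite scalerA mulVf // scale1r.
have := capelli f; rewrite Ef linear0 subr0 Hf E0 linearZ /= E0 scalerA -scalerDl.
rewrite scalerA => ->.
apply: minor_function_sum => i; apply: minor_function_sum => j.
(* Two derivatives lower the degree from d + 1 to d - 1; for d = 0 they give the zero form, which is
   homogeneous of degree 0 as well. *)
apply: minor_function_xminor; apply: (IH d.-1); first by lia.
- by rewrite /cayley rpredB //; apply: (@dhomog_mderiv d); exact: (@dhomog_mderiv d.+1).
- by rewrite polarize_cayley Ef scale0r subr0 /cayley !mderiv0 subrr.
- by rewrite !polarize_cayley Hf.
Qed.

End FirstFundamentalTheorem.

Lemma sum_ord2 (V : nmodType) (h : 'I_2 -> V) : \sum_i h i = h 0 + h 1.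
Proof. by rewrite big_ord_recr big_ord1; congr (h _ + h _); apply/val_inj. Qed.

Lemma det_mx22 (R : comPzRingType) (A : 'M[R]_2) :
  \det A = A 0 0 * A 1 1 - A 0 1 * A 1 0.
Proof.
rewrite (expand_det_row _ 0) sum_ord2 /cofactor !det_mx11 !mxE /=.
rewrite expr0 expr1 mul1r mulN1r mulrN.
by congr (A _ _ * A _ _ - A _ _ * A _ _); apply/val_inj.
Qed.

(** * Polynomials invariant only on a cone *)

Section InvariantsOnCone.
Variables (K : numFieldType) (n : nat) (S : 'M[K]_(n, 2) -> Prop).
Hypothesis S_scale : forall c A, S A -> S (c *: A).
Hypothesis S_SL : forall g A, SL g -> S A -> S (A *m g).
Implicit Types (f : {mpoly K[n + n]}) (u v : bool) (A : 'M[K]_(n, 2)).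

Definition vanishes f := forall A, S A -> f.@[coords A] = 0.

Definition invariant f :=
  forall g A, SL g -> S A -> f.@[coords (A *m g)] = f.@[coords A].

Definition transvection u v (t : K) : 'M[K]_2 :=
  1%:M + t *: delta_mx (idx u) (idx v).

Lemma transvection_SL u v t : u != v -> SL (transvection u v t).
Proof.
case: u v => [] [] //= _; rewrite /SL /transvection det_mx22 !mxE /= !mulr0 !addr0.
  by rewrite mulr1 mul0r subr0.
by rewrite mulr1 mulr0 subr0.
Qed.

Lemma coords_transvection u v t A (k : 'I_(n + n)) :
  coords (A *m transvection u v t) k = coords A k +
  t * (match split k with inl i => if v then 0 else A i (idx u)
                     | inr i => if v then A i (idx u) else 0 end).
Proof.
have E i j : (A *m transvection u v t) i j = A i j + t * (A i (idx u) * (j == idx v)%:R).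
  rewrite /transvection mulmxDr mulmx1 -scalemxAr !mxE; congr (_ + _ * _).
  rewrite (bigD1 (idx u)) //= mxE eqxx /= big1 ?addr0 // => l lu.
  by rewrite mxE (negbTE lu) mulr0.
by rewrite /coords; case: split => i; rewrite E; case: v {E}; rewrite /= ?mulr0 ?mulr1.
Qed.

Lemma polarize_line u v f A : u != v ->
  (polarize u v f).@[coords A] = (line_poly f (coords A)
    (fun k => match split k with inl i => if v then 0 else A i (idx u)
                     | inr i => if v then A i (idx u) else 0 end))`_1.
Proof.
move=> uv; rewrite (proj2 (line_coef01 _ _ _)) big_split_ord /=.
rewrite /polarize raddf_sum /=.
have LE i : split (lshift n i) = inl i by exact: (unsplitK (inl i)).
have RE i : split (rshift n i) = inr i by exact: (unsplitK (inr i)).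
case: v uv => uv; [rewrite [X in _ = X + _]big1 ?add0r|rewrite [X in _ = _ + X]big1 ?addr0].
- by apply: eq_bigr => i _; rewrite mevalM mevalXU coords_pvar RE.
- by move=> i _; rewrite LE mul0r.
- by apply: eq_bigr => i _; rewrite mevalM mevalXU coords_pvar LE.
- by move=> i _; rewrite RE mul0r.
Qed.

(* Polarizations are the derivatives along the one-parameter subgroups of SL_2. *)
Lemma polarize_vanishes u v f : u != v ->
  (forall t A, S A -> f.@[coords (A *m transvection u v t)] = f.@[coords A]) ->
  vanishes (polarize u v f).
Proof.
move=> uv finv A SA; rewrite (polarize_line _ _ uv).
set q := line_poly _ _ _; suff /eqP : q - (f.@[coords A])%:P = 0.
  by rewrite subr_eq0 => /eqP ->; rewrite coefC.
apply: poly_eq0_nat => m; rewrite !hornerE -(finv m.+1%:R A SA) horner_line.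
by rewrite (meval_eq _ (coords_transvection _ _ _ _)) subrr.
Qed.

Lemma vanishes_polarize u v f : u != v -> vanishes f -> vanishes (polarize u v f).
Proof.
move=> uv fS; apply: polarize_vanishes => // t A SA.
by rewrite !fS //; apply: S_SL => //; exact: transvection_SL.
Qed.


Lemma wdeg1 (m : 'X_{1..n + n}) : wdeg (fun=> 1%N) m = mdeg m.
Proof. by rewrite mdegE; apply: eq_bigr => i _; rewrite mul1n. Qed.

Definition hcomp d f := wcomp (fun=> 1%N) d f.

Lemma hcomp_homog d f : hcomp d f \is d.-homog.
Proof.
apply/dhomogP => m; rewrite mcoeff_msupp mcoeff_wcomp wdeg1 /=.
by case: (_ =P d) => // _; rewrite eqxx.
Qed.

Lemma sum_hcomp f : f = \sum_(d < msize f) hcomp d f.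
Proof.
apply/mpolyP => m; rewrite raddf_sum /=.
under eq_bigr => d _ do rewrite mcoeff_wcomp wdeg1.
have [lt|le] := ltnP (mdeg m) (msize f).
  rewrite (bigD1 (Ordinal lt)) //= eqxx big1 ?addr0 // => d /eqP dm.
  by case: eqP => // e; case: dm; apply/val_inj.
rewrite (memN_msupp_eq0 (msize_mdeg_ge le)) big1 // => d _.
by case: eqP => // e; move: (ltn_ord d); rewrite -e ltnNge le.
Qed.

(** Scaling preserves S and commutes with SL_2, so the values of [f] along the rays through A g and
    through A agree, and the coefficients can be compared. *)
Lemma hcomp_invariant d f : invariant f -> invariant (hcomp d f).
Proof.
move=> finv g A SLg SA; rewrite -!coef_wpoly; congr ((_ : {poly K})`_d); apply/eqP.
rewrite -subr_eq0; apply/eqP/poly_eq0_nat => m; rewrite !hornerE !horner_wpoly.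
rewrite !(meval_eq _ (fun k => esym (coordsZ _ (m.+1%:R ^+ 1) k))).
by rewrite scalemxAl finv ?subrr //; exact: S_scale.
Qed.

(* The torus element diag(s, 1/s) followed by scaling by s acts by s^2 on the
   first vector and trivially on the second, so the torus-invariant part of a
   form of degree d is its component of weight d for the weights (2, 0). *)
Definition wcomp0 d f :=
  wcomp (fun k : 'I_(n + n) => if split k is inl _ then 2%N else 0%N) d f.

Lemma wcomp0_homog d f : f \is d.-homog -> wcomp0 d f \is d.-homog.
Proof.
move=> /dhomogP fd; apply/dhomogP => m; rewrite mcoeff_msupp mcoeff_wcomp.
case: (_ =P d) => [_|]; last by rewrite eqxx.
by rewrite -mcoeff_msupp => /fd.
Qed.

(** A monomial with degrees a and b in the two vectors satisfies a + b = d = 2a, whence a = b. *)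
Lemma wcomp0_weight d f : f \is d.-homog ->
  polarize true true (wcomp0 d f) = polarize false false (wcomp0 d f).
Proof.
move=> fd; apply/mpolyP => m; rewrite !mcoeff_polarize.
have [->|fm] := eqVneq ((wcomp0 d f)@_m) 0; first by rewrite !mulr0.
congr (_%:R * _).
have : mdeg m = d.
  by have /dhomogP := wcomp0_homog fd; apply; rewrite mcoeff_msupp.
move: fm; rewrite mcoeff_wcomp; case: (_ =P d) => [<- _|]; last by rewrite eqxx.
rewrite mdegE /wdeg !big_split_ord /=.
have LE i : split (lshift n i) = inl i by exact: (unsplitK (inl i)).
have RE i : split (rshift n i) = inr i by exact: (unsplitK (inr i)).
under [X in _ = (X + _)%N -> _]eq_bigr => i _ do rewrite LE.
under [X in _ = (_ + X)%N -> _]eq_bigr => i _ do rewrite RE mul0n.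
rewrite -big_distrr /= [X in _ = (_ + X)%N -> _]big1 //.
by lia.
Qed.

Lemma wcomp0_eval d f A : invariant f -> f \is d.-homog -> S A ->
  (wcomp0 d f).@[coords A] = f.@[coords A].
Proof.
move=> finv fd SA; rewrite -coef_wpoly; set q := wpoly _ _ _.
suff /eqP : q - f.@[coords A] *: 'X^d = 0.
  by rewrite subr_eq0 => /eqP ->; rewrite coefZ coefXn eqxx mulr1.
apply: poly_eq0_nat => m; rewrite !hornerE horner_wpoly; set s : K := m.+1%:R.
have s0 : s != 0 by rewrite pnatr_eq0.
pose g : 'M[K]_2 := \matrix_(i, j) (if i == j then if i == 0 then s else s^-1 else 0).
have SLg : SL g by rewrite /SL det_mx22 !mxE /= divff // mulr0 subr0.
(* The weighted scaling (s^2, 1) is the torus element diag(s, 1/s) followed by scaling by s;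
   invariance and homogeneity turn the value into s^d times the original one. *)
have -> : f.@[fun i => s ^+ (if split i is inl _ then 2%N else 0%N) * coords A i] =
    f.@[coords (s *: (A *m g))].
  apply: meval_eq => k; rewrite /coords; case: split => i;
    rewrite !mxE sum_ord2 !mxE /=; first by ring.
  by rewrite mulr0 add0r expr0 mul1r mulrCA divff // mulr1.
have -> : f.@[coords (s *: (A *m g))] = s ^+ d * f.@[coords (A *m g)].
  rewrite !mevalE mulr_sumr; apply: eq_big_seq => k kf.
  have /dhomogP /(_ k kf) /= <- := fd.
  rewrite mulrCA; congr (_ * _); rewrite mdegE -prodrXr -big_split /=.
  by apply: eq_bigr => i _; rewrite coordsZ exprMn.
by rewrite finv // mulrC subrr.
Qed.

Lemma invariant_homog d f : invariant f -> f \is d.-homog ->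
  exists2 f', minor_function f' &
    forall A, S A -> f'.@[coords A] = f.@[coords A].
Proof.
move=> finv fd; set h := wcomp0 d f.
have hd : h \is d.-homog by exact: wcomp0_homog.
have hinv : invariant h.
  by move=> g A SLg SA; rewrite !(wcomp0_eval finv fd) //; [exact: finv|exact: S_SL].
pose E := polarize true false : {linear {mpoly K[n + n]} -> {mpoly K[n + n]}}.
pose F := polarize false true : {linear {mpoly K[n + n]} -> {mpoly K[n + n]}}.
pose H : {linear {mpoly K[n + n]} -> {mpoly K[n + n]}} :=
  polarize true true \- polarize false false.
have EF x : E (F x) = F (E x) + H x.
  by rewrite /E /F /H /= polarize_comm /= !scale1r.
have HE z : H (E z) = E (H z) + 2 *: E z.
  have EB x y : E (x - y) = E x - E y by exact: linearB.
  rewrite /H /= EB !(polarize_comm _ _ true false) /= !scale1r !scale0r scaler_nat.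
  by rewrite /E; ring.
have HF z : H (F z) = F (H z) - 2 *: F z.
  have FB x y : F (x - y) = F x - F y by exact: linearB.
  rewrite /H /= FB !(polarize_comm _ _ false true) /= !scale1r !scale0r scaler_nat.
  by rewrite /F; ring.
have Hh : H h = 0 by rewrite /H /= (wcomp0_weight fd) subrr.
have Hh0 : H h = 0 *: h by rewrite scale0r.
have itd (D : {linear {mpoly K[n + n]} -> {mpoly K[n + n]}}) k g :
    (forall x, x \is d.-homog -> D x \is d.-homog) ->
    g \is d.-homog -> iter k D g \is d.-homog.
  by move=> Dd gd; elim: k => //= k; exact: Dd.
(* The weight is the difference of the degrees in the two vectors, at most d, whereas this vector
   would have weight 2 (d + 1). *)
have Eh : iter d.+1 E h = 0.
  have := sl2_wt_iterE HE d.+1 Hh0; set g := iter _ _ _ => gw.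
  have gd : g \is d.-homog by apply: itd => // x; exact: dhomog_polarize.
  apply/mpolyP => m; rewrite mcoeff0; apply/eqP/negPn/negP => gm.
  have : mdeg m = d by have /dhomogP := gd; apply; rewrite mcoeff_msupp.
  have := congr1 (mcoeff m) gw; rewrite /H /= mcoeffB !mcoeff_polarize mcoeffZ.
  rewrite -mulrBl => /(mulIf gm) /eqP; rewrite add0r -natrM subr_eq -natrD eqr_nat.
  move=> /eqP; rewrite mdegE big_split_ord /=; lia.
have Eproj : E (sl2_proj E F d.+1 h) = 0.
  rewrite (sl2_proj_E EF HE HF d Hh) Eh.
  have -> : iter d F 0 = 0 by elim: (d) => //= k ->; exact: linear0.
  by rewrite scaler0.
exists (sl2_proj E F d.+1 h).
  apply: (@fft_homog _ _ d) => //.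
  - rewrite /sl2_proj rpred_sum // => k _; apply: dhomogZ.
    by do 2?apply: (itd) => [x|]; rewrite ?hd //; exact: dhomog_polarize.
  - apply/eqP; rewrite -subr_eq0; apply/eqP; rewrite -[LHS]/(H _).
    have Hk k : H (iter k F (iter k E h)) = 0.
      rewrite (sl2_wt_iterF HF _ (sl2_wt_iterE HE _ Hh0)) add0r subrr.
      by rewrite scale0r.
    rewrite [LHS]linear_sum big1 // => k _.
    by rewrite [LHS]linearZ_LR Hk scaler0.
have van k g : vanishes g -> vanishes (iter k F g).
  by move=> gv; elim: k => [|k IH] //; rewrite iterS; exact: vanishes_polarize.
(* Invariance of [h] on S makes E h vanish on S, so there the projection reduces to its term k = 0,
   which is [h]. *)
have vanE k : vanishes (iter k.+1 E h).
  elim: k => [|k IH]; last by rewrite iterS; exact: vanishes_polarize.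
  apply: polarize_vanishes => // t A SA.
  by apply: hinv => //; exact: transvection_SL.
move=> A SA; rewrite -(wcomp0_eval finv fd SA) -/h /sl2_proj raddf_sum /=.
rewrite big_ord_recl big1 => [|k _]; last first.
  by rewrite mevalZ lift0 van ?mulr0 //; exact: vanE.
by rewrite /= addr0 mevalZ expr0 mul1n divr1 mul1r.
Qed.

Theorem SL2_invariants f : invariant f -> exists2 P : 'M[K]_n -> K,
  polynomial_function P & forall A, S A -> f.@[coords A] = P (minors A).
Proof.
move=> finv.
rewrite {1}(sum_hcomp f); elim: (msize f) => [|N [P Pp Pe]].
  exists (fun=> 0); first exact: polynomial_function_const.
  by move=> A _; rewrite big_ord0 meval0.
have [f' [Q Qp Qe] f'e] := invariant_homog (hcomp_invariant N finv) (hcomp_homog N f).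
exists (fun x : 'M[K]_n => P x + Q x); first exact: polynomial_functionD.
by move=> A SA; rewrite big_ord_recr mevalD Pe // -Qe f'e.
Qed.

End InvariantsOnCone.

(** * The minimal nilpotent orbit of so_8 *)

Section Form.
Variable K : numFieldType.
Implicit Types (u v w t : 'cV[K]_8) (X Y Z : 'M[K]_8) (i j : 'I_8).

Lemma form8E u v : form8 u v = \sum_i u i 0 * v (rev_ord i) 0.
Proof.
rewrite /form8 mxE; under eq_bigr => j _ do rewrite mxE mulr_suml.
rewrite exchange_big; apply: eq_bigr => i _.
rewrite (bigD1 (rev_ord i)) //= !mxE rev_ordK eqxx mulr1 big1 ?addr0 // => j ji.
rewrite !mxE [i == _](_ : _ = false) ?mulr0 ?mul0r //.
by apply: contraNF ji => /eqP ->; rewrite rev_ordK.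
Qed.

Lemma form8C u v : form8 u v = form8 v u.
Proof.
rewrite !form8E (reindex_inj rev_ord_inj); apply: eq_bigr => i _.
by rewrite rev_ordK mulrC.
Qed.

Lemma form8Dl u v w : form8 (u + v) w = form8 u w + form8 v w.
Proof. by rewrite /form8 linearD !mulmxDl mxE. Qed.
Lemma form8Zl c v w : form8 (c *: v) w = c * form8 v w.
Proof. by rewrite /form8 linearZ -!scalemxAl mxE. Qed.
Lemma form8Nl v w : form8 (- v) w = - form8 v w.
Proof. by rewrite -scaleN1r form8Zl mulN1r. Qed.
Lemma form8Bl u v w : form8 (u - v) w = form8 u w - form8 v w.
Proof. by rewrite form8Dl form8Nl. Qed.
Lemma form80l v : form8 0 v = 0.
Proof. by rewrite -(scale0r 0) form8Zl mul0r. Qed.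
Lemma form8Dr u v w : form8 w (u + v) = form8 w u + form8 w v.
Proof. by rewrite !(form8C w) form8Dl. Qed.
Lemma form8Zr c v w : form8 w (c *: v) = c * form8 w v.
Proof. by rewrite !(form8C w) form8Zl. Qed.
Lemma form8Nr v w : form8 w (- v) = - form8 w v.
Proof. by rewrite !(form8C w) form8Nl. Qed.
Lemma form8Br u v w : form8 w (u - v) = form8 w u - form8 w v.
Proof. by rewrite !(form8C w) form8Bl. Qed.
Lemma form80r v : form8 v 0 = 0.
Proof. by rewrite form8C form80l. Qed.

Definition form8_linear := (form8Dl, form8Dr, form8Bl, form8Br, form8Nl, form8Nr,
  form8Zl, form8Zr, form80l, form80r).

Definition basis8 i : 'cV[K]_8 := delta_mx i 0.
Local Notation e := basis8.

Lemma form8_el i u : form8 (e i) u = u (rev_ord i) 0.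
Proof.
rewrite form8E (bigD1 i) //= /basis8 mxE !eqxx mul1r big1 ?addr0 // => j ji.
by rewrite mxE (negbTE ji) mul0r.
Qed.

Lemma form8_ee i j : form8 (e i) (e j) = (rev_ord i == j)%:R.
Proof. by rewrite form8_el /basis8 mxE eqxx andbT. Qed.

Lemma mulmx_colP X Y : (forall u, X *m u = Y *m u) -> X = Y.
Proof.
move=> XY; apply/matrixP => i j; have := XY (e j).
by rewrite -!colE => /colP /(_ i); rewrite !mxE.
Qed.

Lemma so8_skew X u v : X \in so8 K -> form8 (X *m u) v = - form8 (X *m v) u.
Proof. by move=> /so8P ->; rewrite form8C. Qed.

Lemma so8_alt X u : X \in so8 K -> form8 (X *m u) u = 0.
Proof.
move=> /so8_skew h; apply/eqP; have /eqP := h u u.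
by rewrite -addr_eq0 -mulr2n mulrn_eq0.
Qed.

Lemma ad_wedge X u v : X \in so8 K ->
  X *m wedge u v - wedge u v *m X = wedge (X *m u) v + wedge u (X *m v).
Proof.
move=> X8; apply: mulmx_colP => t.
rewrite [LHS]mulmxBl [RHS]mulmxDl -2!mulmxA !wedgeE mulmxBr -!scalemxAr.
have /so8P h := X8; have f w : form8 w (X *m t) = - form8 (X *m w) t by rewrite h opprK.
by rewrite !f !scaleNr; apply/matrixP => i j; rewrite !mxE; ring.
Qed.

Lemma wedgeDl u v w : wedge (u + v) w = wedge u w + wedge v w.
Proof.
apply: mulmx_colP => t; rewrite [RHS]mulmxDl !wedgeE form8Dl.
by apply/matrixP => i j; rewrite !mxE; ring.
Qed.

Lemma wedgeZl c u v : wedge (c *: u) v = c *: wedge u v.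
Proof.
apply: mulmx_colP => t; rewrite -scalemxAl !wedgeE form8Zl.
by apply/matrixP => i j; rewrite !mxE; ring.
Qed.

Lemma wedgeC u v : wedge v u = - wedge u v.
Proof. by rewrite /wedge opprB. Qed.

Lemma wedgeuu u : wedge u u = 0.
Proof. by rewrite /wedge subrr. Qed.

Lemma wedge0l u : wedge 0 u = 0.
Proof. by rewrite -(scale0r 0) wedgeZl scale0r. Qed.

Lemma wedge0r u : wedge u 0 = 0.
Proof. by rewrite wedgeC wedge0l oppr0. Qed.

End Form.

(** * Dimension bounds from triangular systems of functionals *)

Section Flags.
Variables (K : fieldType) (V : vectType K).

(* Each vector of [s] satisfies [P], is detected by its own functional and is
   killed by the earlier ones; a further nonzero vector is killed by all. *)
Fixpoint flag (P : V -> Prop) (s : seq ((V -> K) * V)) : Prop :=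
  match s with
  | [::] => exists2 z, z != 0 & P z
  | (phi, u) :: s' => [/\ scalar phi, P u, phi u != 0 &
                          flag (fun x => P x /\ phi x = 0) s']
  end.

(** Each kernel cuts the current subspace properly, as its own [u] witnesses, and a nonzero vector
    survives all the cuts; hence the strict inequality. *)
Lemma flag_dim (P : V -> Prop) (U : {vspace V}) s :
  (forall x, P x -> x \in U) -> flag P s -> (size s < \dim U)%N.
Proof.
elim: s P U => [|[phi u] s IH] P U PU /=.
  move=> [z z0 /PU zU]; rewrite lt0n dimv_eq0; apply: contraNneq z0 => U0.
  by rewrite -memv0 -U0.
move=> [lphi /PU uU phiu /IH h].
pose C := GRing.isLinear.Build K V K^o _ phi lphi.
pose phi' : {linear V -> K^o} := HB.pack phi C.
have /h lt x : P x /\ phi x = 0 -> x \in (U :&: lker (linfun phi'))%VS.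
  by move=> [/PU xU /eqP phix]; rewrite memv_cap xU memv_ker lfunE.
rewrite (leq_ltn_trans lt) // ltn_neqAle dimvS ?capvSl // andbT.
apply: contraNneq phiu => dimE.
have : u \in (U :&: lker (linfun phi'))%VS.
  by rewrite (_ : (_ :&: _)%VS = U) //; apply/eqP; rewrite eqEdim capvSl dimE leqnn.
by rewrite memv_cap memv_ker lfunE => /andP[_].
Qed.

Lemma flag_ext P Q s : (forall x, P x -> Q x) -> flag P s -> flag Q s.
Proof.
elim: s P Q => [|[phi u] s IH] P Q PQ /=; first by move=> [z z0 /PQ]; exists z.
move=> [lphi /PQ Pu phiu f]; split=> //; apply: IH f => x [/PQ].
by [].
Qed.

(** A whole block can be added at once when its functionals and vectors are dual up to nonzero
    factors. *)
Lemma flag_map (I : eqType) (r : seq I) (phi : I -> V -> K) (u : I -> V) P s :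
  uniq r -> (forall i, scalar (phi i)) -> {in r, forall i, P (u i)} ->
  {in r, forall i, phi i (u i) != 0} ->
  {in r &, forall i j, i != j -> phi i (u j) = 0} ->
  flag (fun x => P x /\ {in r, forall i, phi i x = 0}) s ->
  flag P ([seq (phi i, u i) | i <- r] ++ s).
Proof.
elim: r P => [|i r IH] P /= => [_ _ _ _ _|/andP[ir ur] lphi Pu phiu phi0 f].
  by apply: flag_ext => x [].
split=> //; first by apply: Pu; exact: mem_head.
  by rewrite phiu ?mem_head.
apply: IH => // [j jr|j jr|j k jr kr jk|].
- split; first by apply: Pu; rewrite inE jr orbT.
  rewrite phi0 ?mem_head ?inE ?jr ?orbT //.
  by apply: contraNneq ir => ->.
- by rewrite phiu // inE jr orbT.
- by rewrite phi0 // inE ?jr ?kr orbT.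
apply: flag_ext f => x [Px phix]; split; first by rewrite phix ?mem_head.
by move=> j jr; rewrite phix // inE jr orbT.
Qed.

End Flags.

(* [ring] fails to reify some values of the form unless they are opaque. *)
Ltac form_ring := repeat (let z := fresh in
  match goal with |- context [form8 ?a ?b] => generalize (form8 a b) => z end); ring.

Lemma rev_ord_neq (k : 'I_8) : (rev_ord k == k) = false.
Proof. by apply/eqP => /(congr1 val) /=; lia. Qed.

(** * Coordinate frames adapted to an isotropic plane *)

Section Frame.
Variable K : numFieldType.
Local Notation e := (basis8 K).
Variables i j : 'I_8.
Hypotheses (ij : i != j) (irj : rev_ord i != j).

Let v := e i.
Let w := e j.
Let v' := e (rev_ord i).
Let w' := e (rev_ord j).
(** The four indices whose basis vectors span the orthogonal of the two hyperbolic planes of v, v'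
    and w, w'. *)
Definition rest := enum [predC [:: i; j; rev_ord i; rev_ord j]].

Lemma size_rest : size rest = 4%N.
Proof.
have ir := rev_ord_neq i; have jr := rev_ord_neq j.
have : uniq [:: i; j; rev_ord i; rev_ord j].
  rewrite /= !inE !negb_or ij (eq_sym i (rev_ord i)) ir (eq_sym j (rev_ord j)) jr.
  rewrite (eq_sym j) irj (inj_eq rev_ord_inj) ij.
  by rewrite -(inj_eq rev_ord_inj) rev_ordK irj.
move=> /card_uniqP /= c; have := cardC (mem [:: i; j; rev_ord i; rev_ord j]).
rewrite c card_ord => /(@addnI 4 _ 4) E; rewrite /rest -cardE -[RHS]E.
by apply: eq_card => k.
Qed.
Let c1 := (form8_ee, @rev_ordK 8, inj_eq (@rev_ord_inj 8), rev_ord_neq, eqxx).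

Lemma frame_forms : [/\ (form8 v v = 0) * (form8 w w = 0) * (form8 v w = 0) * (form8 w v = 0),
  (form8 v v' = 1) * (form8 w w' = 1) * (form8 v w' = 0) * (form8 w v' = 0),
  (form8 v' v = 1) * (form8 w' w = 1) * (form8 w' v = 0) * (form8 v' w = 0) &
  {in rest, forall k, (form8 (e k) v = 0) * (form8 (e k) w = 0) * (form8 v (e (rev_ord k)) = 0) *
    (form8 w (e (rev_ord k)) = 0)}].
Proof.
have ji : (j == i) = false by rewrite eq_sym; apply/negbTE.
have rji : (rev_ord j == i) = false.
  by rewrite -(inj_eq rev_ord_inj) rev_ordK eq_sym (negbTE irj).
split; rewrite /v /w /v' /w' ?c1 ?(negbTE ij) ?(negbTE irj) ?ji ?rji
  ?(eq_sym j (rev_ord i)) ?(negbTE irj) //.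
move=> k; rewrite mem_enum !inE !negb_or => /and4P[ki kj kri krj].
have rk l : (rev_ord k == l) = (k == rev_ord l) by rewrite -(inj_eq rev_ord_inj) rev_ordK.
by rewrite !c1 !rk !(eq_sym _ k) (negbTE ki) (negbTE kj) (negbTE kri) (negbTE krj).
Qed.

End Frame.

Section MinimalOrbit.
Variables (K : numFieldType) (X : 'M[K]_8).
Hypothesis X8 : X \in so8 K.
Local Notation e := (basis8 K).

Definition brk (Y : 'M[K]_8) := X *m Y - Y *m X.

Lemma brk_wedge p q t : brk (wedge p q) *m t =
  form8 (X *m p) t *: q - form8 q t *: (X *m p) +
  (form8 p t *: (X *m q) - form8 (X *m q) t *: p).
Proof. by rewrite /brk ad_wedge // mulmxDl !wedgeE. Qed.

Lemma brk_mem Y : Y \in so8 K -> brk Y \in (ad X @: so8 K)%VS.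
Proof. by move=> Y8; have := memv_img (ad X) Y8; rewrite /ad lfunE. Qed.

Section Frame.
Variables i j : 'I_8.
Hypotheses (ij : i != j) (irj : rev_ord i != j).
Let v := e i.
Let w := e j.
Let v' := e (rev_ord i).
Let w' := e (rev_ord j).
Hypotheses (dimX : (orbit_dim X <= 10)%N) (a0 : form8 (X *m v) w != 0).

(* [ad X] maps so_8 onto the ten-dimensional space of values of the functionals
   (Z v, w), (Z w, e_k), (Z v, e_k) and tr(Z | <v, w>); if the image of [ad X] is
   no larger, then an element of it on which they all vanish is zero. *)
Lemma brk_key Y al be ga : Y \in so8 K ->
  brk Y *m v = al *: v + be *: w -> brk Y *m w = ga *: v - al *: w -> brk Y = 0.
Proof.
move=> Y8 Yv Yw; apply/eqP/negPn/negP => Y0; move: dimX.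
have [E1 E2 E3 Er] := frame_forms K ij irj.
have Xvv u : form8 (X *m u) u = 0 by exact: so8_alt.
have Xwv : form8 (X *m w) v = - form8 (X *m v) w by exact: so8_skew.
have sc p q : scalar (fun Z : 'M[K]_8 => form8 (Z *m p) q).
  by move=> c Z1 Z2; rewrite mulmxDl -scalemxAl !form8_linear.
(* The pivots are (X v, w) up to sign, and twice it for the last functional. These 10 functionals
   together with the surviving [brk Y] force dimension at least 11. *)
suff fl : flag (fun Z => Z \in (ad X @: so8 K)%VS)
    ((fun Z => form8 (Z *m v) w, brk (wedge v v')) ::
     [seq (fun Z => form8 (Z *m w) (e (rev_ord k)), brk (wedge v (e k))) | k <- rest i j] ++
     [seq (fun Z => form8 (Z *m v) (e (rev_ord k)), brk (wedge w (e k))) | k <- rest i j] ++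
     [:: (fun Z => form8 (Z *m v) v' + form8 (Z *m w) w', brk (wedge v w))]).
  rewrite leqNgt; have := flag_dim (fun _ h => h) fl.
  by rewrite /= !size_cat !size_map (size_rest ij irj) => ->.
have mem p q := brk_mem (wedge_so8 p q).
have dl k l : (k == l)%:R = form8 (e l) (e (rev_ord k)) :> K.
  by rewrite form8_ee (inj_eq (@rev_ord_inj 8)) eq_sym.
have Na0 : - form8 (X *m v) w != 0 by rewrite oppr_eq0.
split=> //.
  rewrite !brk_wedge !form8_linear !(E1, E2, E3, Xvv, Xwv).
  by rewrite [Z in Z != 0](_ : _ = - form8 (X *m v) w) //; form_ring.
apply: flag_map => [|k|k kr|k kr|k l kr lr kl|].
- exact: enum_uniq.
- exact: sc.
- split; first exact: mem.
  by rewrite !brk_wedge !form8_linear !(E1, E2, E3, Xvv, Xwv, Er k kr); form_ring.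
- rewrite !brk_wedge !form8_linear !(E1, E2, E3, Xvv, Xwv, Er k kr) -dl eqxx mulr1n.
  by rewrite [Z in Z != 0](_ : _ = form8 (X *m v) w) //; form_ring.
- rewrite !brk_wedge !form8_linear !(E1, E2, E3, Xvv, Xwv, Er k kr, Er l lr) -dl.
  by rewrite (negbTE kl) mulr0n; form_ring.
apply: flag_map => [|k|k kr|k kr|k l kr lr kl|].
- exact: enum_uniq.
- exact: sc.
- split; first split; first exact: mem.
    by rewrite !brk_wedge !form8_linear !(E1, E2, E3, Xvv, Xwv, Er k kr); form_ring.
  move=> l lr.
  by rewrite !brk_wedge !form8_linear !(E1, E2, E3, Xvv, Xwv, Er k kr, Er l lr); form_ring.
- rewrite !brk_wedge !form8_linear !(E1, E2, E3, Xvv, Xwv, Er k kr) -dl eqxx mulr1n.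
  by rewrite [Z in Z != 0](_ : _ = - form8 (X *m v) w) //; form_ring.
- rewrite !brk_wedge !form8_linear !(E1, E2, E3, Xvv, Xwv, Er k kr, Er l lr) -dl.
  by rewrite (negbTE kl) mulr0n; form_ring.
split.
- by move=> c Z1 Z2; rewrite !sc /= mulrDr addrACA.
- split; first split; first split; first exact: mem.
  + by rewrite !brk_wedge !form8_linear !(E1, E2, E3, Xvv, Xwv); form_ring.
  + move=> l lr.
    by rewrite !brk_wedge !form8_linear !(E1, E2, E3, Xvv, Xwv, Er l lr); form_ring.
  + move=> l lr.
    by rewrite !brk_wedge !form8_linear !(E1, E2, E3, Xvv, Xwv, Er l lr); form_ring.
- rewrite !brk_wedge !form8_linear !(E1, E2, E3, Xvv, Xwv).
  by rewrite [Z in Z != 0](_ : _ = 2 * form8 (X *m v) w) ?mulf_neq0 ?pnatr_eq0 //; form_ring.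
(* The hypotheses on [Y] say that [X, Y] preserves the plane of v and w with trace zero there, which
   is what the ten functionals test. *)
exists (brk Y) => //.
split; first split; first split; first split; first exact: brk_mem.
- by rewrite Yv !form8_linear !(E1, E2, E3); form_ring.
- by move=> l lr; rewrite Yw !form8_linear !(Er l lr); form_ring.
- by move=> l lr; rewrite Yv !form8_linear !(Er l lr); form_ring.
- by rewrite Yv Yw !form8_linear !(E1, E2, E3); form_ring.
Qed.

End Frame.
End MinimalOrbit.

(** * Nilpotent elements with a small orbit are isotropic wedges *)

Section SmallOrbit.
Variables (K : numFieldType) (X : 'M[K]_8).
Hypotheses (X8 : X \in so8 K) (dimX : (orbit_dim X <= 10)%N).
Local Notation e := (basis8 K).
Let Xuu u : form8 (X *m u) u = 0. Proof. exact: so8_alt. Qed.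
Let Xskew p q : form8 (X *m p) q = - form8 (X *m q) p. Proof. exact: so8_skew. Qed.

Section Frame.
Variables i j : 'I_8.
Hypotheses (ij : i != j) (irj : rev_ord i != j) (a0 : form8 (X *m e i) (e j) != 0).
Let v := e i.
Let w := e j.
Let a := form8 (X *m v) w.

(** Projection along v and w onto the orthogonal of X v and X w. It exists because (X v, v) = (X w,
    w) = 0 and (X v, w) = - (X w, v) = a is invertible. *)
Definition orth_proj t :=
  t + (form8 t (X *m w) / a) *: v - (form8 t (X *m v) / a) *: w.

Let Xwv : form8 (X *m w) v = - a. Proof. exact: Xskew. Qed.

Lemma orth_proj_perp t : form8 (X *m v) (orth_proj t) = 0 /\
  form8 (X *m w) (orth_proj t) = 0.
Proof.
rewrite /orth_proj !form8_linear !Xuu Xwv -/a !(form8C t).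
by split; field.
Qed.

Lemma orth_proj_rest k : k \in rest i j ->
  (form8 (orth_proj (e k)) v = 0) * (form8 (orth_proj (e k)) w = 0).
Proof.
move=> kr; have [E1 E2 E3 Er] := frame_forms K ij irj.
by rewrite /orth_proj !form8_linear !(E1, E2, E3, Er k kr) !mulr0 !addr0 subr0.
Qed.

Lemma orth_proj_dual k l : k \in rest i j -> l \in rest i j ->
  form8 (orth_proj (e k)) (e (rev_ord l)) = (k == l)%:R.
Proof.
move=> kr lr; have [E1 E2 E3 Er] := frame_forms K ij irj.
rewrite /orth_proj !form8_linear !(Er l lr) form8_ee (inj_eq (@rev_ord_inj 8)).
by rewrite !mulr0 addr0 subr0.
Qed.

(** With y the projection of e_k, the hypotheses make [X, y /\ z] kill v and w, so [brk_key] applies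
    with all three coefficients 0. The conclusion is the vanishing bracket evaluated at [t]. *)
Lemma brk_wedge_eq0 k z t : k \in rest i j ->
  form8 (X *m v) z = 0 -> form8 (X *m w) z = 0 ->
  form8 z v *: (X *m orth_proj (e k)) = 0 ->
  form8 z w *: (X *m orth_proj (e k)) = 0 ->
  form8 (X *m orth_proj (e k)) t *: z - form8 z t *: (X *m orth_proj (e k)) +
  (form8 (orth_proj (e k)) t *: (X *m z) - form8 (X *m z) t *: orth_proj (e k)) = 0.
Proof.
move=> kr zv zw zXv zXw; have [y1 y2] := orth_proj_perp (e k).
have yr := orth_proj_rest kr.
suff br0 : brk X (wedge (orth_proj (e k)) z) = 0.
  by rewrite -brk_wedge // br0 mul0mx.
apply: (@brk_key _ _ X8 _ _ ij irj dimX a0 _ 0 0 0).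
- exact: wedge_so8.
- rewrite brk_wedge // !yr (Xskew _ v) y1 (Xskew z) zv zXv.
  by rewrite !(oppr0, scale0r, subr0, addr0).
- rewrite brk_wedge // !yr (Xskew _ w) y2 (Xskew z) zw zXw.
  by rewrite !(oppr0, scale0r, subr0, addr0).
Qed.

(** For two of these vectors, X y_p /\ y_q + y_p /\ X y_q = 0. A third index makes each y_p an
    eigenvector, and the eigenvalues of any two are opposite; around a cycle of three they must
    vanish. *)
Lemma mul_orth_proj_rest k l m : k \in rest i j -> l \in rest i j ->
  m \in rest i j -> k != l -> k != m -> l != m -> X *m orth_proj (e k) = 0.
Proof.
pose y k := orth_proj (e k); rewrite -/(y k) => kr lr mr kl km lm.
have yd p q : p \in rest i j -> q \in rest i j ->
  form8 (y p) (e (rev_ord q)) = (p == q)%:R := @orth_proj_dual p q.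
have key p q t : p \in rest i j -> q \in rest i j ->
    form8 (X *m y p) t *: y q - form8 (y q) t *: (X *m y p) +
    (form8 (y p) t *: (X *m y q) - form8 (X *m y q) t *: y p) = 0.
  move=> pr qr; have [y1 y2] := orth_proj_perp (e q).
  by apply: brk_wedge_eq0 => //; rewrite (orth_proj_rest qr) scale0r.
clearbody y.
have ypq p q : p \in rest i j -> q \in rest i j -> p != q -> X *m y p =
    form8 (X *m y p) (e (rev_ord q)) *: y q - form8 (X *m y q) (e (rev_ord q)) *: y p.
  move=> pr qr pq; apply/eqP; rewrite eq_sym -subr_eq0; apply/eqP.
  rewrite -[RHS](key p q (e (rev_ord q)) pr qr) !yd // eqxx (negbTE pq).
  by rewrite mulr1n mulr0n scale1r scale0r sub0r addrAC.
have diag p q r : p \in rest i j -> q \in rest i j -> r \in rest i j ->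
    p != q -> p != r -> q != r ->
    X *m y p = - form8 (X *m y q) (e (rev_ord q)) *: y p.
  move=> pr qr rr pq pqr qr'; rewrite (ypq p q) // (ypq p r pr rr) // !form8_linear.
  rewrite !yd // (negbTE pq) eq_sym (negbTE qr').
  by rewrite !mulr0n !mulr0 subr0 scale0r sub0r scaleNr.
have lam p q r : p \in rest i j -> q \in rest i j -> r \in rest i j ->
    p != q -> p != r -> q != r ->
    form8 (X *m y p) (e (rev_ord p)) = - form8 (X *m y q) (e (rev_ord q)).
  move=> pr qr rr pq pqr qr'; rewrite (diag p q r) // !form8_linear.
  by rewrite yd // eqxx mulr1.
have l0 : form8 (X *m y l) (e (rev_ord l)) = 0.
  have := lam l k m lr kr mr; rewrite eq_sym => /(_ kl lm km).
  rewrite (lam k m l) // ?(eq_sym m) // opprK (lam m l k) // 1?eq_sym // => /eqP.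
  by rewrite -addr_eq0 -mulr2n mulrn_eq0 => /eqP.
by rewrite (diag k l m) // l0 oppr0 scale0r.
Qed.

Lemma rest3 : exists k l m, [/\ k \in rest i j, l \in rest i j & m \in rest i j] /\
  [/\ k != l, k != m & l != m].
Proof.
have := enum_uniq [predC [:: i; j; rev_ord i; rev_ord j]].
have := size_rest ij irj; rewrite -/(rest i j).
case: (rest i j) => [|k [|l [|m r]]] // _ /= /and3P[kn ln _].
exists k, l, m; rewrite !inE !eqxx !orbT; split=> //.
by move: kn ln; rewrite !inE !negb_or => /and3P[-> -> _] /andP[-> _].
Qed.

(** Once X kills y_k, the bracket with y_k /\ z leaves y_k /\ X z = 0, so X z is a multiple of y_k.
    The same holds for y_l, and the two are independent. *)
Lemma perp_ker z : form8 (X *m v) z = 0 -> form8 (X *m w) z = 0 -> X *m z = 0.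
Proof.
move=> zv zw; have [k [l [m [[kr lr mr] [kl km lm]]]]] := rest3.
have Xk := mul_orth_proj_rest kr lr mr kl km lm.
have Xl : X *m orth_proj (e l) = 0.
  by apply: (mul_orth_proj_rest lr kr mr); rewrite // eq_sym.
have zE n : n \in rest i j -> X *m orth_proj (e n) = 0 ->
    X *m z = form8 (X *m z) (e (rev_ord n)) *: orth_proj (e n).
  move=> nr Xn; have := @brk_wedge_eq0 n z (e (rev_ord n)) nr zv zw.
  rewrite Xn !scaler0 form80l orth_proj_dual // eqxx scale1r scale0r subr0 add0r.
  by move=> /(_ erefl erefl) /eqP; rewrite subr_eq0 => /eqP.
rewrite (zE k) // (zE l) // form8Zl orth_proj_dual // eq_sym (negbTE kl).
by rewrite mulr0n mulr0 scale0r.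
Qed.

(** Each t differs from its projection, which X kills, by an explicit combination of v and w. *)
Lemma X_wedge : X = a^-1 *: wedge (X *m v) (X *m w).
Proof.
apply: mulmx_colP => t; have [t1 t2] := orth_proj_perp t.
have := perp_ker t1 t2; rewrite -scalemxAl wedgeE /orth_proj.
rewrite mulmxBr mulmxDr -!scalemxAr !(form8C t) => /eqP.
rewrite subr_eq0 => /eqP h; rewrite -[LHS](addrK ((form8 (X *m w) t / a) *: (X *m v))) h.
by rewrite scalerBr !scalerA !(mulrC a^-1).
Qed.

(* [u := X p] lies in the radical of the span of [X v] and [X w]; then [p /\ u]
   is a value of [ad X] to which [brk_key] applies. *)
Lemma gram_eq0 : form8 (X *m v) (X *m w) ^+ 2 =
    form8 (X *m v) (X *m v) * form8 (X *m w) (X *m w) ->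
  form8 (X *m v) (X *m v) = 0.
Proof.
set G12 := form8 _ _; set G11 := form8 _ _; set G22 := form8 _ _ => G.
have G21 : form8 (X *m w) (X *m v) = G12 by rewrite form8C.
apply/eqP/negPn/negP => G0; have [E1 E2 E3 _] := frame_forms K ij irj.
pose p := G12 *: v - G11 *: w.
have uE : X *m p = G12 *: (X *m v) - G11 *: (X *m w).
  by rewrite mulmxBr -!scalemxAr.
have ker z : form8 (X *m v) z = 0 -> form8 (X *m w) z = 0 -> X *m z = 0.
  exact: perp_ker.
have Xu : X *m (X *m p) = 0.
  apply: ker; rewrite uE !form8_linear -/G11 -/G12 -/G22 ?G21; first by ring.
  by rewrite -expr2 G subrr.
(* Chosen so that p - c X v is orthogonal to X v; it is then orthogonal to X w too, since both
   pairings of p are proportional to the Gram entries. *)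
pose c := form8 (X *m v) p / G11.
have vp : form8 (X *m v) p = - G11 * a.
  by rewrite /p !form8_linear Xuu -/a; ring.
have wp : form8 (X *m w) p = - G12 * a.
  by rewrite /p !form8_linear Xuu Xwv; ring.
have Xt : X *m (p - c *: (X *m v)) = 0.
  apply: ker; rewrite form8Br form8Zr -?/G11 ?G21 /c ?vp ?wp; by field.
(* Since X kills p - c X v and X p, the bracket is (p - c X v) /\ X p + c X v /\ X p, that is p /\ X
   p. *)
pose Y := wedge (p - c *: (X *m v)) p + wedge (c *: v) (X *m p).
have Y8 : Y \in so8 K by rewrite rpredD ?wedge_so8.
have YE : brk X Y = wedge p (X *m p).
  rewrite /brk /Y mulmxDr mulmxDl opprD addrACA !ad_wedge // Xt Xu -!scalemxAr.
  by rewrite wedge0l wedge0r add0r addr0 wedgeDl -scaleNr wedgeZl scaleNr wedgeZl subrK.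
have uv : form8 (X *m p) v = G11 * a.
  by rewrite Xskew vp; ring.
have uw : form8 (X *m p) w = G12 * a.
  by rewrite Xskew wp; ring.
have pv : form8 p v = 0 by rewrite /p !form8_linear !(E1, E2, E3); ring.
have pw : form8 p w = 0 by rewrite /p !form8_linear !(E1, E2, E3); ring.
have Yv : brk X Y *m v = (- G11 * a * G12) *: v + (G11 * a * G11) *: w.
  rewrite YE wedgeE uv pv scale0r sub0r /p.
  by apply/matrixP => r s; rewrite !mxE; ring.
have Yw : brk X Y *m w = (- G12 * a * G12) *: v - (- G11 * a * G12) *: w.
  rewrite YE wedgeE uw pw scale0r sub0r /p.
  by apply/matrixP => r s; rewrite !mxE; ring.
have Y0 : brk X Y = 0.
  exact: (@brk_key _ _ X8 _ _ ij irj dimX a0 _ (- G11 * a * G12) (G11 * a * G11)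
    (- G12 * a * G12)).
have := congr1 (fun z : 'cV[K]_8 => form8 z (e (rev_ord j))) Yv.
rewrite Y0 mul0mx !form8_linear !(E1, E2, E3) mulr0 add0r mulr1 => /eqP.
by rewrite eq_sym !mulf_eq0 (negbTE G0) (negbTE a0).
Qed.

End Frame.

Lemma small_nilpotent_wedge n : X != 0 -> X ^+ n = 0 ->
  exists v1 v2, [/\ form8 v1 v1 = 0, form8 v2 v2 = 0, form8 v1 v2 = 0 &
                    X = wedge v1 v2].
Proof.
move=> X0 Xn.
have eigen0 (Y : 'M[K]_8) (u : 'cV[K]_8) c :
    Y ^+ n = 0 -> u != 0 -> Y *m u = c *: u -> c = 0.
  move=> Yn u0 Yu; have : Y ^+ n *m u = c ^+ n *: u.
    elim: (n) => [|m IH]; first by rewrite mul1mx expr0 scale1r.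
    by rewrite exprSr -[Y ^+ m * Y]/(Y ^+ m *m Y) -mulmxA Yu -scalemxAr IH scalerA -exprS.
  rewrite Yn mul0mx => /eqP; rewrite eq_sym scaler_eq0 (negbTE u0) orbF expf_eq0.
  by case/andP => _ /eqP.
(* If no coordinate pair works, all off-diagonal entries of X vanish, the antidiagonal ones by
   skewness; a diagonal nilpotent matrix is zero. *)
have [[i j] /= /and3P[ij irj a0]|none] := pickP (fun p : 'I_8 * 'I_8 =>
    [&& p.1 != p.2, rev_ord p.1 != p.2 & form8 (X *m e p.1) (e p.2) != 0]); last first.
  have diag i : X *m e i = X i i *: e i.
    apply/colP => k; rewrite /basis8 -colE !mxE eqxx andbT.
    have [->|ki] := eqVneq k i; first by rewrite mulr1.
    rewrite mulr0; have := none (i, rev_ord k); rewrite /= (inj_eq (@rev_ord_inj 8)).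
    rewrite (eq_sym i k) (negbTE ki) /= form8C form8_el rev_ordK /basis8 -colE mxE.
    have [ri|] := eqVneq i (rev_ord k); last by move=> _ /negbT /negPn /eqP.
    move=> _; have := Xuu (e i); rewrite form8C form8_el /basis8 -colE mxE.
    by rewrite ri rev_ordK.
  case/eqP: X0; apply: mulmx_colP => u; rewrite mul0mx.
  have -> : u = \sum_i u i 0 *: e i.
    apply/colP => k; rewrite summxE (bigD1 k) //= !mxE !eqxx mulr1 big1 ?addr0 // => l lk.
    by rewrite !mxE eq_sym (negbTE lk) mulr0.
  rewrite mulmx_sumr big1 // => i _; rewrite -scalemxAr diag (eigen0 X (e i) (X i i)) //.
    by rewrite scale0r scaler0.
  by apply/eqP => /colP /(_ i) /eqP; rewrite !mxE !eqxx oner_eq0.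
have ji : j != i by rewrite eq_sym.
have rji : rev_ord j != i by rewrite -(inj_eq (@rev_ord_inj 8)) rev_ordK eq_sym.
have b0 : form8 (X *m e j) (e i) != 0 by rewrite Xskew oppr_eq0.
pose s1 := X *m e i; pose s2 := X *m e j.
have XE := X_wedge ij irj a0.
(* On the span of s1 and s2 the operator X^2 is a scalar, a nonzero multiple of the Gram
   determinant; nilpotency makes it vanish. *)
have G : form8 s1 s2 ^+ 2 = form8 s1 s1 * form8 s2 s2.
  set a := form8 (X *m e i) (e j) in a0 XE.
  suff : a^-1 ^+ 2 * (form8 s1 s2 ^+ 2 - form8 s1 s1 * form8 s2 s2) = 0.
    move/eqP; rewrite mulf_eq0 expf_eq0 invr_eq0 (negbTE a0) andbF /= subr_eq0.
    by move/eqP.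
  have XE' t : X *m t = a^-1 *: (form8 s1 t *: s2 - form8 s2 t *: s1).
    by rewrite {1}XE -scalemxAl wedgeE.
  apply: (eigen0 (X ^+ 2) s1).
  - by rewrite exprAC Xn expr0n.
  - by apply: contraNneq a0 => s10; rewrite /a -/s1 s10 form80l.
  rewrite expr2 -[X * X]/(X *m X) -mulmxA (XE' s1) -scalemxAr mulmxBr -!scalemxAr.
  rewrite !XE' (form8C s2 s1) !scalerBr !scalerA.
  by apply/matrixP => r q; rewrite !mxE; ring.
have G11 : form8 s1 s1 = 0 := gram_eq0 ij irj a0 G.
(* The roles of the two frame vectors are symmetric, so the previous argument is applied to the
   frame with i and j exchanged. *)
have G22 : form8 s2 s2 = 0.
  by apply: (gram_eq0 ji rji b0); rewrite form8C G mulrC.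
have G12 : form8 s1 s2 = 0.
  by apply/eqP; rewrite -sqrf_eq0 G G11 mul0r.
exists ((form8 s1 (e j))^-1 *: s1), s2; split=> //.
- by rewrite !form8_linear G11 !mulr0.
- by rewrite !form8_linear G12 mulr0.
by rewrite wedgeZl.
Qed.

End SmallOrbit.

Local Notation i0 := (@Ordinal 8 0 isT).
Local Notation i1 := (@Ordinal 8 1 isT).
Local Notation i2 := (@Ordinal 8 2 isT).
Local Notation i3 := (@Ordinal 8 3 isT).
Local Notation i4 := (@Ordinal 8 4 isT).
Local Notation i5 := (@Ordinal 8 5 isT).
Local Notation i6 := (@Ordinal 8 6 isT).
Local Notation i7 := (@Ordinal 8 7 isT).

Section MinimalIsWedge.
Variable K : numFieldType.
Local Notation e := (basis8 K).


Lemma sum_ord8 (V : nmodType) (F : 'I_8 -> V) :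
  \sum_i F i = F i0 + F i1 + F i2 + F i3 + F i4 + F i5 + F i6 + F i7.
Proof.
rewrite !big_ord_recr big_ord0 /= add0r.
by congr (F _ + F _ + F _ + F _ + F _ + F _ + F _ + F _); apply/val_inj.
Qed.

Lemma vec8E (u : 'cV[K]_8) : u = \sum_i u i 0 *: e i.
Proof.
apply/colP => k; rewrite summxE (bigD1 k) //= !mxE !eqxx mulr1 big1 ?addr0 // => l lk.
by rewrite !mxE eq_sym (negbTE lk) mulr0.
Qed.

(** Brackets have the form Y e_0 /\ e_1 + e_0 /\ Y e_1 up to sign, and skewness of Y leaves ten free
    coefficients. Minimality transfers this upper bound to the orbit under study. *)
Lemma orbit_dim_standard : (orbit_dim (wedge (e i0) (e i1)) <= 10)%N.
Proof.
pose L := [:: wedge (e i0) (e i1); wedge (e i2) (e i1); wedge (e i3) (e i1);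
  wedge (e i4) (e i1); wedge (e i5) (e i1); wedge (e i0) (e i2);
  wedge (e i0) (e i3); wedge (e i0) (e i4); wedge (e i0) (e i5);
  wedge (e i6) (e i1) - wedge (e i0) (e i7)].
apply: leq_trans (dim_span L); apply: dimvS; apply/subvP => Z /memv_imgP[Y Y8 ->].
rewrite /ad lfunE /=.
have -> : wedge (e i0) (e i1) *m Y - Y *m wedge (e i0) (e i1) =
    - (wedge (Y *m e i0) (e i1) + wedge (e i0) (Y *m e i1)).
  by rewrite -ad_wedge // opprB.
have y7 : (Y *m e i0) i7 0 = 0.
  have := so8_alt (e i0) Y8; rewrite form8C form8_el => <-.
  by congr (fun_of_matrix _ _ _); apply/val_inj.
have y6 : (Y *m e i1) i6 0 = 0.
  have := so8_alt (e i1) Y8; rewrite form8C form8_el => <-.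
  by congr (fun_of_matrix _ _ _); apply/val_inj.
have y67 : (Y *m e i1) i7 0 = - (Y *m e i0) i6 0.
  have := so8_skew (e i1) (e i0) Y8; rewrite !(form8C (Y *m _)) !form8_el => h.
  by rewrite (_ : i7 = rev_ord i0) ?h; [congr (- fun_of_matrix _ _ _)|]; apply/val_inj.
set y := Y *m e i0 in y7 y67 *; set z := Y *m e i1 in y6 y67 *.
have -> : wedge y (e i1) + wedge (e i0) z =
    (y i0 0 + z i1 0) *: wedge (e i0) (e i1) + y i2 0 *: wedge (e i2) (e i1)
    + y i3 0 *: wedge (e i3) (e i1) + y i4 0 *: wedge (e i4) (e i1)
    + y i5 0 *: wedge (e i5) (e i1) + z i2 0 *: wedge (e i0) (e i2)
    + z i3 0 *: wedge (e i0) (e i3) + z i4 0 *: wedge (e i0) (e i4)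
    + z i5 0 *: wedge (e i0) (e i5)
    + y i6 0 *: (wedge (e i6) (e i1) - wedge (e i0) (e i7)).
  rewrite [in LHS](vec8E y) [in LHS](vec8E z) !sum_ord8 y7 y6 y67 !scale0r !addr0.
  rewrite [wedge (e i0) _]wedgeC !wedgeDl !wedgeZl !wedgeuu.
  rewrite !(wedgeC (e i0)).
  repeat match goal with |- context [wedge ?a ?b] => generalize (wedge a b) => ? end.
  by apply/matrixP => p q; rewrite !mxE; ring.
have mem k : (k < 10)%N -> L`_k \in <<L>>%VS.
  by move=> lt; apply: memv_span; exact: mem_nth.
have memZ c A B : A \in <<L>>%VS -> B \in <<L>>%VS -> A + c *: B \in <<L>>%VS.
  by move=> AL BL; rewrite rpredD // rpredZ.
rewrite rpredN.
apply: (memZ); last exact: (mem 9%N isT).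
apply: (memZ); last exact: (mem 8%N isT).
apply: (memZ); last exact: (mem 7%N isT).
apply: (memZ); last exact: (mem 6%N isT).
apply: (memZ); last exact: (mem 5%N isT).
apply: (memZ); last exact: (mem 4%N isT).
apply: (memZ); last exact: (mem 3%N isT).
apply: (memZ); last exact: (mem 2%N isT).
apply: (memZ); last exact: (mem 1%N isT).
apply: rpredZ; exact: (mem 0%N isT).

Qed.

Lemma minimal_nilpotent_wedge (O : 'M[K]_8 -> Prop) : minimal_nilpotent_orbit O ->
  exists v1 v2, [/\ form8 v1 v1 = 0, form8 v2 v2 = 0, form8 v1 v2 = 0,
    wedge v1 v2 != 0 & forall Y, O Y <-> adjoint_orbit (wedge v1 v2) Y].
Proof.
move=> [X [[X8 X0 [n Xn]] OX Xmin]].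
have ee i j : form8 (e i) (e j) = (rev_ord i == j)%:R := form8_ee _ i j.
have Snz : nonzero_nilpotent (wedge (e i0) (e i1)).
  split; first exact: wedge_so8.
    apply/eqP => /(congr1 (fun A => (A *m e i7) i1 0)).
    rewrite wedgeE !ee mul0mx (_ : (rev_ord i0 == i7) = true) //.
    rewrite (_ : (rev_ord i1 == i7) = false) // mulr1n scale1r scale0r subr0 !mxE.
    by move/eqP; rewrite oner_eq0.
  exists 2%N; apply: mulmx_colP => u; rewrite mul0mx expr2.
  rewrite -[_ * _]/(wedge (e i0) (e i1) *m wedge (e i0) (e i1)) -mulmxA.
  rewrite !wedgeE !form8_linear !ee (_ : (rev_ord i0 == i1) = false) //.
  rewrite (_ : (rev_ord i0 == i0) = false) // (_ : (rev_ord i1 == i1) = false) //.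
  rewrite (_ : (rev_ord i1 == i0) = false) //.
  by rewrite !mulr0n !mulr0 subr0 !scale0r subr0.
have [|v1 [v2 [v11 v22 v12 XE]]] := small_nilpotent_wedge X8 _ X0 Xn.
  exact: leq_trans (Xmin _ Snz) orbit_dim_standard.
by exists v1, v2; rewrite -XE.
Qed.

End MinimalIsWedge.

(** * Transitivity on isotropic pairs *)

Section Witt.
Variable K : numFieldType.
Local Notation e := (basis8 K).
Local Notation J := (J8 K).
Implicit Types (g h : 'M[K]_8) (u v w x : 'cV[K]_8).

Definition orthogonal_mx g := g^T *m J *m g = J.

Lemma J8_invol : J *m J = 1%:M.
Proof.
apply: mulmx_colP => u; rewrite mul1mx -mulmxA.
have JE v i : (J *m v) i 0 = v (rev_ord i) 0.
  rewrite mxE (bigD1 (rev_ord i)) //= mxE rev_ordK eqxx mul1r big1 ?addr0 // => j ji.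
  by rewrite mxE -(inj_eq rev_ord_inj) rev_ordK eq_sym (negbTE ji) mul0r.
by apply/colP => i; rewrite !JE rev_ordK.
Qed.

Lemma orthogonal_mxP g : orthogonal_mx g <->
  (forall u v, form8 (g *m u) (g *m v) = form8 u v).
Proof.
have E u v : form8 (g *m u) (g *m v) = (u^T *m (g^T *m J *m g) *m v) 0 0.
  by rewrite /form8 trmx_mul !mulmxA.
have ent A i j : ((e i)^T *m A *m e j) 0 0 = A i j :> K.
  by rewrite /basis8 trmx_delta -rowE -colE !mxE.
split=> [gJ u v|gJ]; first by rewrite E gJ.
by apply/matrixP => i j; rewrite -!ent -E gJ.
Qed.

Lemma orthogonal_mxM g h : orthogonal_mx g -> orthogonal_mx h -> orthogonal_mx (g *m h).
Proof.
move=> /orthogonal_mxP go /orthogonal_mxP ho; apply/orthogonal_mxP => u v.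
by rewrite -!mulmxA go ho.
Qed.

Lemma orthogonal_mx_unit g : orthogonal_mx g -> g \in unitmx.
Proof.
move=> gJ; have : J *m g^T *m J *m g = 1%:M by rewrite -!mulmxA !(mulmxA g^T) gJ J8_invol.
by case/mulmx1_unit.
Qed.

Lemma orthogonal_mxV g : orthogonal_mx g -> orthogonal_mx (invmx g).
Proof.
move=> go; have gu := orthogonal_mx_unit go; have /orthogonal_mxP gf := go.
by apply/orthogonal_mxP => u v; rewrite -gf !mulKVmx.
Qed.

Lemma orthogonal_mx_det g : orthogonal_mx g -> \det g = 1 \/ \det g = -1.
Proof.
move=> /(congr1 determinant); rewrite !det_mulmx det_tr => dg.
have dJ : \det J != 0.
  have /mulmx1_unit[JU _] := J8_invol.
  by move: JU; rewrite unitmxE unitfE.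
have /eqP : \det g ^+ 2 = 1.
  by apply: (mulIf dJ); rewrite mul1r -[RHS]dg expr2 mulrAC.
by rewrite sqrf_eq1 => /orP[] /eqP; [left|right].
Qed.

Definition reflection w : 'M[K]_8 :=
  1%:M - (2 / form8 w w) *: (w *m (w^T *m J)).

Lemma reflectionE w u :
  reflection w *m u = u - (2 * form8 w u / form8 w w) *: w.
Proof.
rewrite /reflection mulmxBl mul1mx -scalemxAl -mulmxA.
rewrite [w^T *m J *m u]mx11_scalar mul_mx_scalar -/(form8 w u) scalerA.
by congr (_ - _ *: _); ring.
Qed.

Lemma reflection_orthogonal w : form8 w w != 0 -> orthogonal_mx (reflection w).
Proof.
move=> w0; apply/orthogonal_mxP => u v.
rewrite !reflectionE !form8_linear (form8C u w); by field.
Qed.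

Lemma reflection_fix w u : form8 w u = 0 -> reflection w *m u = u.
Proof. by move=> wu; rewrite reflectionE wu mulr0 mul0r scale0r subr0. Qed.

(** The reflection in u - v does it: the norm of u - v is -2 (u, v), which is nonzero. *)
Lemma isotropic_move u v : form8 u u = 0 -> form8 v v = 0 -> form8 u v != 0 ->
  exists2 g, orthogonal_mx g & g *m u = v /\
    forall x, form8 u x = 0 -> form8 v x = 0 -> g *m x = x.
Proof.
move=> uu vv uv; pose w := u - v.
have ww : form8 w w = - (2 * form8 u v).
  by rewrite /w !form8_linear uu vv (form8C v u); ring.
have wu : form8 w u = - form8 u v by rewrite /w !form8_linear uu (form8C v u); ring.
exists (reflection w); first by apply: reflection_orthogonal;
  rewrite ww oppr_eq0 mulf_neq0 ?pnatr_eq0.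
split=> [|x ux vx].
  rewrite reflectionE ww wu [Z in Z *: _](_ : _ = 1) ?scale1r; last by field.
  by rewrite /w opprB addrC subrK.
by apply: reflection_fix; rewrite /w !form8_linear ux vx subrr.
Qed.

(** One reflection suffices if u pairs nontrivially with e_p; otherwise two are composed through an
    intermediate isotropic vector. The list of fixed vectors lets a later move keep a basis vector
    already reached. *)
Lemma isotropic_to_basis (p k : 'I_8) u : form8 u u = 0 -> u k 0 != 0 ->
  exists2 g, orthogonal_mx g & g *m u = e p /\
    forall x, form8 u x = 0 -> form8 (e p) x = 0 -> form8 (e (rev_ord p)) x = 0 ->
      form8 (e (rev_ord k)) x = 0 -> g *m x = x.
Proof.
move=> uu uk.
have fe q : form8 u (e (rev_ord q)) = u q 0 by rewrite form8C form8_el rev_ordK.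
have ee q : form8 (e q) (e q) = 0 by rewrite form8_ee rev_ord_neq.
have [up|up] := eqVneq (u (rev_ord p) 0) 0; last first.
  have up' : form8 u (e p) != 0 by rewrite -(rev_ordK p) fe.
  have [g go [gu gx]] := isotropic_move uu (ee p) up'.
  by exists g => //; split=> // x ux px _ _; exact: gx.
suff [w [ww uw wp wx]] : exists w, [/\ form8 w w = 0, form8 u w != 0, form8 w (e p) != 0 &
    forall x, form8 (e (rev_ord p)) x = 0 -> form8 (e (rev_ord k)) x = 0 -> form8 w x = 0].
  have [g go [gu gx]] := isotropic_move uu ww uw.
  have [h ho [hu hx]] := isotropic_move ww (ee p) wp.
  exists (h *m g); first exact: orthogonal_mxM.
  split=> [|x ux px rpx rkx]; rewrite -mulmxA; first by rewrite gu.
  by rewrite gx ?hx ?wx.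
have [kp|kp] := eqVneq k p.
  exists (e (rev_ord p)); rewrite ee fe -kp uk; split=> //.
  by rewrite form8_ee rev_ordK eqxx oner_eq0.
have krp : k != rev_ord p by apply: contraNneq uk => ->; rewrite up.
have [u_p|u_p] := eqVneq (u p 0) 0; last first.
  exists (e (rev_ord p)); rewrite ee fe u_p; split=> //.
  by rewrite form8_ee rev_ordK eqxx oner_eq0.
(* Here u_p = 0, so e_(rev p) alone is orthogonal to u; adding e_(rev k) makes the pairing with u
   equal to u_k. *)
exists (e (rev_ord p) + e (rev_ord k)); split.
- have prk : (p == rev_ord k) = false.
    by rewrite -(inj_eq rev_ord_inj) rev_ordK eq_sym (negbTE krp).
  by rewrite !form8_linear !ee !form8_ee !rev_ordK prk (negbTE krp) !addr0.
- by rewrite form8Dr !fe u_p add0r uk.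
- by rewrite form8Dl !form8_ee !rev_ordK eqxx (negbTE kp) addr0 oner_eq0.
- by move=> x px kx; rewrite form8Dl px kx addr0.
Qed.


Lemma isotropic_pair_to_basis u v : form8 u u = 0 -> form8 v v = 0 ->
  form8 u v = 0 -> wedge u v != 0 ->
  exists2 g, orthogonal_mx g & g *m u = e i0 /\ g *m v = e i1.
Proof.
move=> uu vv uv uv0.
have [k uk] : exists k, u k 0 != 0.
  apply/existsP; apply: contraNT uv0; rewrite negb_exists => /forallP u0.
  rewrite (_ : u = 0) ?wedge0l //; apply/colP => k; rewrite mxE.
  by apply/eqP; have := u0 k; rewrite negbK.
have [g go [gu _]] := isotropic_to_basis i0 uu uk.
have /orthogonal_mxP gf := go.
(* A nonzero coordinate away from 0 is wanted because the second move must fix e_0; it exists since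
   g v is not a multiple of e_0. *)
have [l l0 vl] : exists2 l, l != i0 & (g *m v) l 0 != 0.
  apply/exists_inP; apply: contraNT uv0; rewrite negb_exists_in => /forall_inP v0.
  have vE : v = (g *m v) i0 0 *: u.
    rewrite -[LHS](mulKmx (orthogonal_mx_unit go)) -[u in RHS](mulKmx (orthogonal_mx_unit go)).
    rewrite scalemxAr gu; congr (_ *m _); apply/colP => k'; rewrite [RHS]mxE [e _ _ _]mxE eqxx andbT.
    have [->|k0] := eqVneq k' i0; first by rewrite mulr1.
    by apply/eqP; rewrite mulr0; have := v0 _ k0; rewrite negbK.
  by rewrite vE wedgeC wedgeZl wedgeuu scaler0 oppr0.
have [h ho [hv hx]] := isotropic_to_basis i1 (etrans (gf v v) vv) vl.
exists (h *m g); first exact: orthogonal_mxM.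
rewrite -!mulmxA; split=> //; rewrite gu hx // -?gu ?gf 1?form8C //.
- by rewrite gu form8_ee.
- by rewrite gu form8_ee.
- by rewrite gu form8_ee (inj_eq rev_ord_inj) eq_sym (negbTE l0).
Qed.

Lemma wedge_transitive u v u' v' :
  form8 u u = 0 -> form8 v v = 0 -> form8 u v = 0 -> wedge u v != 0 ->
  form8 u' u' = 0 -> form8 v' v' = 0 -> form8 u' v' = 0 -> wedge u' v' != 0 ->
  exists2 g, SO8 g & g *m u = u' /\ g *m v = v'.
Proof.
move=> uu vv uv uv0 uu' vv' uv' uv0'.
have [g go [gu gv]] := isotropic_pair_to_basis uu vv uv uv0.
have [h ho [hu hv]] := isotropic_pair_to_basis uu' vv' uv' uv0'.
have hU := orthogonal_mx_unit ho.
have [] := orthogonal_mx_det (orthogonal_mxM (orthogonal_mxV ho) go) => d1.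
  exists (invmx h *m g).
    by split=> //; apply: orthogonal_mxM => //; exact: orthogonal_mxV.
  by rewrite -!mulmxA gu gv -hu -hv !mulKmx.
(* Exchanging the mutually dual vectors e_3 and e_4 is orthogonal of determinant -1 and fixes e_0
   and e_1, so it corrects the determinant. *)
pose s : 'M[K]_8 := tperm_mx (@Ordinal 8 3 isT) (@Ordinal 8 4 isT).
have sE x i : (s *m x) i 0 = x (tperm (@Ordinal 8 3 isT) (@Ordinal 8 4 isT) i) 0.
  by rewrite /s -row_permE mxE.
have so : orthogonal_mx s.
  apply/orthogonal_mxP => x y; rewrite !form8E.
  under eq_bigr => i _ do rewrite !sE.
  rewrite [RHS](reindex_inj (@perm_inj _ (tperm (@Ordinal 8 3 isT) (@Ordinal 8 4 isT)))).
  apply: eq_bigr => i _; congr (_ * y _ 0).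
  case: (tpermP (@Ordinal 8 3 isT) (@Ordinal 8 4 isT) i) => [->|->|n3 n4].
  - by rewrite (_ : rev_ord _ = @Ordinal 8 4 isT) ?tpermR; apply/val_inj.
  - by rewrite (_ : rev_ord _ = @Ordinal 8 3 isT) ?tpermL; apply/val_inj.
  - by rewrite tpermD //; apply/eqP => /(congr1 (@rev_ord 8)); rewrite rev_ordK => E;
      [apply: n4|apply: n3]; rewrite -E; apply/val_inj.
have ds : \det s = -1 by rewrite /s det_perm odd_tperm expr1.
have s0 : s *m e i0 = e i0.
  by apply/colP => i; rewrite sE !mxE; case: tpermP => [->|->|].
have s1 : s *m e i1 = e i1.
  by apply/colP => i; rewrite sE !mxE; case: tpermP => [->|->|].
exists (invmx h *m s *m g).
  split; first by do 2?apply: orthogonal_mxM => //; exact: orthogonal_mxV.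
  by move: d1; rewrite !det_mulmx ds => d1; rewrite mulrAC d1 mulrNN mulr1.
by rewrite -!mulmxA gu gv s0 s1 -hu -hv !mulKmx.
Qed.

Lemma conj_wedge g u v : orthogonal_mx g ->
  g *m wedge u v *m invmx g = wedge (g *m u) (g *m v).
Proof.
move=> go; have gU := orthogonal_mx_unit go; have /orthogonal_mxP gf := go.
apply: mulmx_colP => t; rewrite -!mulmxA !wedgeE mulmxBr -!scalemxAr.
by rewrite -(gf u) -(gf v) !mulKVmx.
Qed.

End Witt.

(** * Equations of the orbit closure *)

Section Closure.
Variable K : numFieldType.
Local Notation e := (basis8 K).
Implicit Types (u v : 'cV[K]_8) (Y : 'M[K]_8).

Definition isotropic_wedge Y := exists u v,
  [/\ form8 u u = 0, form8 v v = 0, form8 u v = 0 & Y = wedge u v].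

Lemma wedge_entry u v i j :
  wedge u v i j = v i 0 * u (rev_ord j) 0 - u i 0 * v (rev_ord j) 0.
Proof.
have JE (x : 'cV[K]_8) : (x^T *m J8 K) 0 j = x (rev_ord j) 0.
  rewrite mxE (bigD1 (rev_ord j)) //= !mxE eqxx mulr1 big1 ?addr0 // => k kj.
  by rewrite !mxE (negbTE kj) mulr0.
by rewrite /wedge !mxE !big_ord1 !JE.
Qed.

Definition plucker Y i j := - Y i (rev_ord j).

Lemma plucker_wedge u v i j :
  plucker (wedge u v) i j = u i 0 * v j 0 - u j 0 * v i 0.
Proof. by rewrite /plucker wedge_entry rev_ordK; ring. Qed.

(** A nonzero coordinate (k, l) gives the factors: column l divided by it, and row k. The third
    family of equations, Y^2 = 0 in coordinates, says that all columns are isotropic and mutually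
    orthogonal. *)
Lemma isotropic_wedge_plucker Y :
  (forall i j, plucker Y i j + plucker Y j i = 0) ->
  (forall i j k l, plucker Y i j * plucker Y k l - plucker Y i k * plucker Y j l
     + plucker Y i l * plucker Y j k = 0) ->
  (forall j k, \sum_i plucker Y i j * plucker Y (rev_ord i) k = 0) ->
  isotropic_wedge Y.
Proof.
move=> P1 P2 P3; have P1' i j : plucker Y i j = - plucker Y j i.
  by apply/eqP; rewrite -addr_eq0 P1.
have [[k l] /= kl|none] := pickP (fun p : 'I_8 * 'I_8 => plucker Y p.1 p.2 != 0);
  last first.
  exists 0, 0; rewrite !form80l wedge0l; split=> //; apply/matrixP => i j; rewrite mxE.
  have := none (i, rev_ord j); rewrite /plucker /= rev_ordK oppr_eq0.
  by move/negbT/negPn/eqP.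
set c := plucker Y k l in kl.
exists (\col_i (plucker Y i l / c)), (\col_j plucker Y k j).
have iso p q j j' (x y : 'cV[K]_8) : (forall i, x i 0 = p * plucker Y i j) ->
    (forall i, y i 0 = q * plucker Y i j') -> form8 x y = 0.
  move=> xE yE; rewrite form8E.
  under eq_bigr => i _ do rewrite xE yE mulrACA.
  by rewrite -mulr_sumr P3 mulr0.
have aE i : (\col_i (plucker Y i l / c)) i 0 = c^-1 * plucker Y i l by rewrite mxE mulrC.
have bE i : (\col_j plucker Y k j) i 0 = -1 * plucker Y i k by rewrite mxE P1' mulN1r.
split; [exact: (iso _ _ _ _ _ _ aE aE)|exact: (iso _ _ _ _ _ _ bE bE)|
  exact: (iso _ _ _ _ _ _ aE bE)|].
apply/matrixP => i j; rewrite wedge_entry !mxE.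
have := P2 i (rev_ord j) k l.
rewrite -/c [Y i j](_ : _ = - plucker Y i (rev_ord j)); last first.
  by rewrite /plucker rev_ordK opprK.
move=> h; apply: (mulIf kl); apply/eqP; rewrite -subr_eq0 -oppr_eq0 -[X in _ == X]h.
rewrite (P1' i k) (P1' (rev_ord j) k).
by apply/eqP; field.
Qed.

Lemma plucker_polynomial i j : polynomial_function (fun Y => plucker Y i j).
Proof.
have := polynomial_functionB (polynomial_function_const _ 0)
  (polynomial_function_entry K i (rev_ord j)).
by apply: polynomial_function_ext => Y; rewrite sub0r.
Qed.

Lemma minimal_closureP (O : 'M[K]_8 -> Prop) : minimal_nilpotent_orbit O ->
  forall Y, zariski_closure O Y <-> isotropic_wedge Y.
Proof.
move=> /minimal_nilpotent_wedge [v1 [v2 [v11 v22 v12 v0 OE]]] Y.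
have OP u v : form8 u u = 0 -> form8 v v = 0 -> form8 u v = 0 -> wedge u v != 0 ->
    O (wedge u v).
  move=> uu vv uv uv0; apply/OE.
  have [g SOg [<- <-]] := wedge_transitive v11 v22 v12 v0 uu vv uv uv0.
  by exists g => //; rewrite conj_wedge //; case: SOg.
have OW Z : O Z -> isotropic_wedge Z.
  move=> /OE [g [go _] ->]; rewrite conj_wedge //; have /orthogonal_mxP gf := go.
  by exists (g *m v1), (g *m v2); rewrite !gf.
split=> [clY|[u [v [uu vv uv ->]]]]; last first.
  move=> f [p pE] f0; have [uv0|] := eqVneq (wedge u v) 0; last first.
    by move=> uv0; apply: f0; exact: OP.
  rewrite uv0 pE.
  (* The zero matrix is reached along a ray: the nonzero multiples of the generator lie in the
     orbit, so a polynomial vanishing on the orbit vanishes at 0 too. *)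
  pose q := wpoly (fun=> 1%N) p (fun i => coord (vbasis {:'M[K]_8}) i (wedge v1 v2)).
  have qE s : q.[s] = f (s *: wedge v1 v2).
    by rewrite horner_wpoly pE; apply: meval_eq => i; rewrite linearZ.
  have <- : q.[0] = p.@[fun i => coord (vbasis {:'M[K]_8}) i 0].
    by rewrite qE scale0r pE.
  suff -> : q = 0 by rewrite horner0.
  apply: poly_eq0_nat => n; rewrite qE; apply: f0; rewrite -wedgeZl; apply: OP.
  - by rewrite !form8_linear v11 !mulr0.
  - by [].
  - by rewrite form8Zl v12 mulr0.
  - by rewrite wedgeZl scaler_eq0 negb_or pnatr_eq0.
have pp := plucker_polynomial.
apply: isotropic_wedge_plucker => [i j|i j k l|j k].
- apply: (clY (fun Y => plucker Y i j + plucker Y j i)).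
    exact: polynomial_functionD.
  by move=> _ /OW[u [v [_ _ _ ->]]]; rewrite !plucker_wedge; ring.
- apply: (clY (fun Y => plucker Y i j * plucker Y k l - plucker Y i k * plucker Y j l
     + plucker Y i l * plucker Y j k)).
    by apply: polynomial_functionD; [apply: polynomial_functionB|]; exact: polynomial_functionM.
  by move=> _ /OW[u [v [_ _ _ ->]]]; rewrite !plucker_wedge; ring.
- apply: (clY (fun Y => \sum_i plucker Y i j * plucker Y (rev_ord i) k)).
    by apply: polynomial_function_sum => i; exact: polynomial_functionM.
  move=> _ /OW[u [v [uu vv uv ->]]].
  transitivity (v j 0 * v k 0 * form8 u u - v j 0 * u k 0 * form8 u v
     - u j 0 * v k 0 * form8 v u + u j 0 * u k 0 * form8 v v).
    rewrite !form8E !mulr_sumr -!sumrB -big_split /=; apply: eq_bigr => i _.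
    by rewrite !plucker_wedge; ring.
  by rewrite uu vv (form8C v) uv !mulr0 !subr0 addr0.
Qed.

End Closure.

(** * The map F *)

Section MapFMatrix.
Variable K : numFieldType.
Implicit Types (x : TstarV K) (A : 'M[K]_(8, 2)).

Definition Fmx x : 'M[K]_(8, 2) := \matrix_(i, j) F x (delta_mx j 0) i 0.

Lemma ord8P (P : 'I_8 -> Prop) : P i0 -> P i1 -> P i2 -> P i3 -> P i4 -> P i5 ->
  P i6 -> P i7 -> forall i, P i.
Proof.
move=> p0 p1 p2 p3 p4 p5 p6 p7 [[|[|[|[|[|[|[|[|//]]]]]]]] lt];
  by rewrite (bool_irrelevance lt isT).
Qed.

Lemma ord2P (P : 'I_2 -> Prop) : P 0 -> P 1 -> forall j, P j.
Proof.
move=> p0 p1 [[|[|//]] lt].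
  by rewrite [Ordinal lt](_ : _ = 0) //; apply/val_inj.
by rewrite [Ordinal lt](_ : _ = 1) //; apply/val_inj.
Qed.

Lemma ord3P (P : 'I_3 -> Prop) : P 0 -> P 1 -> P 2 -> forall j, P j.
Proof.
move=> p0 p1 p2 [[|[|[|//]]] lt].
- by rewrite [Ordinal lt](_ : _ = 0) //; apply/val_inj.
- by rewrite [Ordinal lt](_ : _ = 1) //; apply/val_inj.
- by rewrite [Ordinal lt](_ : _ = 2) //; apply/val_inj.
Qed.

Lemma eta_entries (z : 'cV[K]_3) (a b : K) (w : 'rV[K]_3) :
  ((Defs.eta z a b w i0 0 = - w 0 2) * (Defs.eta z a b w i1 0 = z 0 0) *
   (Defs.eta z a b w i2 0 = z 1 0) * (Defs.eta z a b w i3 0 = a)) *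
  ((Defs.eta z a b w i4 0 = b) * (Defs.eta z a b w i5 0 = w 0 1) *
   (Defs.eta z a b w i6 0 = w 0 0) * (Defs.eta z a b w i7 0 = - z 2 0)).
Proof.
have e8E k (lt : (k < 8)%N) i : e8 K k.+1 i 0 = (i == Ordinal lt)%:R.
  rewrite /e8 mxE eqxx andbT /=; congr (_ == _)%:R.
  by apply/val_inj; rewrite /= inordK.
have E i : Defs.eta z a b w i 0 = z 0 0 * (i == i1)%:R + z 1 0 * (i == i2)%:R
  - z 2 0 * (i == i7)%:R + a * (i == i3)%:R + b * (i == i4)%:R
  - w 0 2 * (i == i0)%:R + w 0 1 * (i == i5)%:R + w 0 0 * (i == i6)%:R.
  rewrite /Defs.eta -(e8E 1%N) -(e8E 2%N) -(e8E 7%N) -(e8E 3%N)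
    -(e8E 4%N) -(e8E 0%N) -(e8E 5%N) -(e8E 6%N).
  by rewrite !mxE.
by rewrite !E /=; do !split; ring.
Qed.

Lemma Ffunctional_delta x j (y : 'cV[K]_3) t :
  Ffunctional x (delta_mx j 0) y t =
  if j == 0 then - (beta2 x *m y + alpha1 x *m t) 1 0
  else (beta2 x *m y + alpha1 x *m t) 0 0.
Proof.
rewrite /Ffunctional det_mx22.
set c := beta2 x *m y + _; have E i : row_mx c (delta_mx j (0 : 'I_1)) i 0 = c i 0.
  by rewrite mxE; case: splitP => // k _; rewrite (ord1 k).
have E' i : row_mx c (delta_mx j (0 : 'I_1)) i 1 = (i == j)%:R.
  by rewrite mxE; case: splitP => [[[|k] lt]|k _] //; rewrite mxE (ord1 k) andbT.
rewrite !E !E'; move: j E E'; apply: ord2P => _ _ /=; ring.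
Qed.

Lemma Fmx_entries x :
  ((Fmx x i0 0 = beta2 x 1 2) * (Fmx x i1 0 = alpha2 x 0 0) *
   (Fmx x i2 0 = alpha2 x 1 0) * (Fmx x i3 0 = - beta1 x 0 0) *
   (Fmx x i4 0 = - alpha1 x 1 0) * (Fmx x i5 0 = - beta2 x 1 1) *
   (Fmx x i6 0 = - beta2 x 1 0) * (Fmx x i7 0 = - alpha2 x 2 0)) *
  ((Fmx x i0 1 = - beta2 x 0 2) * (Fmx x i1 1 = alpha2 x 0 1) *
   (Fmx x i2 1 = alpha2 x 1 1) * (Fmx x i3 1 = - beta1 x 0 1) *
   (Fmx x i4 1 = alpha1 x 0 0) * (Fmx x i5 1 = beta2 x 0 1) *
   (Fmx x i6 1 = beta2 x 0 0) * (Fmx x i7 1 = - alpha2 x 2 1)).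
Proof.
have md m n (B : 'M[K]_(m, n)) i j : (B *m delta_mx j (0 : 'I_1)) i 0 = B i j.
  by rewrite -colE mxE.
have m1 (B : 'M[K]_(2, 1)) i : (B *m 1%:M) i 0 = B i 0 by rewrite mulmx1.
have F1 j : Ffunctional x (delta_mx j 0) 0 1%:M =
    if j == 0 then - alpha1 x 1 0 else alpha1 x 0 0.
  by rewrite Ffunctional_delta mulmx0 add0r !m1.
have F2 j i : Ffunctional x (delta_mx j 0) (delta_mx i 0) 0 =
    if j == 0 then - beta2 x 1 i else beta2 x 0 i.
  by rewrite Ffunctional_delta mulmx0 addr0 !md.
rewrite /Fmx /F; do !split; rewrite mxE !eta_entries ?F1 ?md //;
  by rewrite mxE F2 /= ?opprK.
Qed.

End MapFMatrix.

Section FmxIso.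
Variable K : numFieldType.
Implicit Types (x : TstarV K) (A : 'M[K]_(8, 2)) (g : 'M[K]_2).

Definition Fmx_inv A : TstarV K :=
  (\col_i (if i == 0 then A i4 1 else - A i4 0),
   \matrix_(i, j) (if i == 0 then A i1 j else if i == 1 then A i2 j else - A i7 j),
   \row_j (- A i3 j),
   \matrix_(i, j) (if i == 0
     then (if j == 0 then A i6 1 else if j == 1 then A i5 1 else - A i0 1)
     else (if j == 0 then - A i6 0 else if j == 1 then - A i5 0 else A i0 0))).

Lemma Fmx_invK : cancel Fmx_inv (@Fmx K).
Proof.
move=> A; apply/matrixP; apply: ord8P; apply: ord2P;
  by rewrite !Fmx_entries /alpha1 /alpha2 /beta1 /beta2 /= !mxE /= ?opprK.
Qed.

Lemma FmxK : cancel (@Fmx K) Fmx_inv.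
Proof.
move=> [[[a1 a2] b1] b2]; rewrite /Fmx_inv; congr (_, _, _, _); apply/matrixP.
- by apply: ord2P => j; rewrite (ord1 j) mxE /= !Fmx_entries ?opprK.
- by apply: ord3P; apply: ord2P; rewrite mxE /= !Fmx_entries ?opprK.
- by move=> i; rewrite (ord1 i); apply: ord2P; rewrite mxE /= !Fmx_entries ?opprK.
- by apply: ord2P; apply: ord3P; rewrite mxE /= !Fmx_entries ?opprK.
Qed.

Lemma Fmx_inv_is_linear : linear Fmx_inv.
Proof.
move=> c A B; rewrite /Fmx_inv; congr (_, _, _, _); apply/matrixP => i j;
  by rewrite !mxE; repeat match goal with |- context [if ?b then _ else _] => case: b end; ring.
Qed.

HB.instance Definition _ :=
  GRing.isLinear.Build K 'M[K]_(8, 2) (TstarV K) _ Fmx_inv Fmx_inv_is_linear.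

Lemma Fmx_is_linear : linear (@Fmx K).
Proof.
move=> c x y; apply: (can_inj Fmx_invK).
by rewrite FmxK Fmx_inv_is_linear !FmxK.
Qed.

HB.instance Definition _ :=
  GRing.isLinear.Build K (TstarV K) 'M[K]_(8, 2) _ (@Fmx K) Fmx_is_linear.

Lemma sum_ord3 (V : nmodType) (h : 'I_3 -> V) : \sum_i h i = h 0 + h 1 + h 2.
Proof.
by rewrite !big_ord_recr big_ord0 /= add0r; congr (h _ + h _ + h _); apply/val_inj.
Qed.

Lemma Nset_entries x : let B := alpha1 x *m beta1 x - beta2 x *m alpha2 x in
  Nset x <-> [/\ B 0 1 = 0, B 1 0 = 0 & B 0 0 = B 1 1].
Proof.
move=> B; rewrite /Nset /moment_map -/B.
have tE (X : 'M[K]_2) : \tr (B *m X) =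
    B 0 0 * X 0 0 + B 0 1 * X 1 0 + (B 1 0 * X 0 1 + B 1 1 * X 1 1).
  by move: B => B; rewrite /mxtrace sum_ord2 !mxE !sum_ord2.
clearbody B.
split=> [h|[B01 B10 B00] X]; last first.
  rewrite tE B01 B10 B00 /mxtrace sum_ord2 => /eqP; rewrite addr_eq0 => /eqP ->.
  by ring.
have h' (X : 'M[K]_2) : X 0 0 + X 1 1 = 0 ->
    B 0 0 * X 0 0 + B 0 1 * X 1 0 + (B 1 0 * X 0 1 + B 1 1 * X 1 1) = 0.
  by move=> X0; rewrite -tE; apply: h; rewrite /mxtrace sum_ord2.
split.
- by have := h' (delta_mx 1 0); rewrite !mxE /= addr0 => /(_ erefl) <-; ring.
- by have := h' (delta_mx 0 1); rewrite !mxE /= addr0 => /(_ erefl) <-; ring.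
- have := h' (\matrix_(i, j) (if i == j then if i == 0 then 1 else -1 else 0)).
  rewrite !mxE /= subrr => /(_ erefl) h0; apply/eqP; rewrite -subr_eq0 -[X in _ == X]h0.
  by apply/eqP; ring.
Qed.

Lemma gram_form8 A i j : (A^T *m J8 K *m A) i j = form8 (col i A) (col j A).
Proof.
rewrite /form8 tr_col -row_mul !mxE; apply: eq_bigr => k _.
by rewrite [row _ _ _ _]mxE [col _ _ _ _]mxE.
Qed.

Definition isotropic A := A^T *m J8 K *m A = 0.

(** The Gram entries of the two columns are 2 B_10, -2 B_01 and B_11 - B_00, the components of the
    moment map on sl_2. *)
Lemma Nset_isotropic x : Nset x <-> isotropic (Fmx x).
Proof.
have gE i j : (Fmx x)^T *m J8 K *m Fmx x = 0 -> form8 (col i (Fmx x)) (col j (Fmx x)) = 0.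
  by move=> h; rewrite -gram_form8 h mxE.
pose B := alpha1 x *m beta1 x - beta2 x *m alpha2 x.
have f8 i j : form8 (col i (Fmx x)) (col j (Fmx x)) =
    \sum_k Fmx x k i * Fmx x (rev_ord k) j.
  by rewrite form8E; apply: eq_bigr => k _; rewrite !mxE.
have rE : ((rev_ord i0 = i7) * (rev_ord i1 = i6) * (rev_ord i2 = i5) * (rev_ord i3 = i4)) *
  ((rev_ord i4 = i3) * (rev_ord i5 = i2) * (rev_ord i6 = i1) * (rev_ord i7 = i0)).
  by do !split; apply/val_inj.
have BE i j : B i j = alpha1 x i 0 * beta1 x 0 j -
    (beta2 x i 0 * alpha2 x 0 j + beta2 x i 1 * alpha2 x 1 j + beta2 x i 2 * alpha2 x 2 j).
  by rewrite /B !mxE big_ord1 sum_ord3.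
have f00 : form8 (col 0 (Fmx x)) (col 0 (Fmx x)) = 2 * B 1 0.
  by rewrite f8 sum_ord8 !rE !Fmx_entries BE; ring.
have f11 : form8 (col 1 (Fmx x)) (col 1 (Fmx x)) = - (2 * B 0 1).
  by rewrite f8 sum_ord8 !rE !Fmx_entries BE; ring.
have f01 : form8 (col 0 (Fmx x)) (col 1 (Fmx x)) = B 1 1 - B 0 0.
  by rewrite f8 sum_ord8 !rE !Fmx_entries !BE; ring.
have n2 : (2 : K) != 0 by rewrite pnatr_eq0.
split=> [/Nset_entries [B01 B10 B00]|h].
  apply/matrixP; apply: ord2P; apply: ord2P; rewrite gram_form8 mxE.
  - by rewrite f00 -/B in B10 *; rewrite B10 mulr0.
  - by rewrite f01 -/B in B00 *; rewrite B00 subrr.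
  - by rewrite form8C f01 -/B in B00 *; rewrite B00 subrr.
  - by rewrite f11 -/B in B01 *; rewrite B01 mulr0 oppr0.
apply/Nset_entries; rewrite -/B; split; apply/eqP.
- by have /eqP := gE 1 1 h; rewrite f11 oppr_eq0 mulf_eq0 (negbTE n2).
- by have /eqP := gE 0 0 h; rewrite f00 mulf_eq0 (negbTE n2).
- by have /eqP := gE 0 1 h; rewrite f01 subr_eq0 eq_sym.
Qed.

Lemma isotropicZ c A : isotropic A -> isotropic (c *: A).
Proof.
have E : (c *: A)^T = c *: A^T by apply/matrixP => i j; rewrite !mxE.
by rewrite /isotropic => A0; rewrite E -scalemxAr -!scalemxAl A0 !scaler0.
Qed.

Lemma isotropicM g A : SL g -> isotropic A -> isotropic (A *m g).
Proof.
rewrite /isotropic => _ A0; rewrite trmx_mul !mulmxA -(mulmxA g^T) -(mulmxA g^T) A0.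
by rewrite mulmx0 mul0mx.
Qed.

Lemma SL_unit g : SL g -> g \in unitmx.
Proof. by rewrite /SL unitmxE => ->; exact: unitr1. Qed.

Lemma SL_inv g : SL g -> SL (invmx g).
Proof. by move=> g1; rewrite /SL det_inv g1 invr1. Qed.

Lemma invmx_SL2 g : SL g ->
  (invmx g 0 0 = g 1 1) * (invmx g 0 1 = - g 0 1) *
  (invmx g 1 0 = - g 1 0) * (invmx g 1 1 = g 0 0).
Proof.
move=> g1; pose h : 'M[K]_2 := \matrix_(i, j)
  (if i == j then (if i == 0 then g 1 1 else g 0 0) else - g i j).
have gh : g *m h = 1%:M.
  rewrite /SL det_mx22 in g1.
  apply/matrixP; apply: ord2P; apply: ord2P; rewrite mxE sum_ord2 !mxE /= ?mulr1n ?mulr0n -?g1; ring.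
have -> : invmx g = h by rewrite -[LHS]mulmx1 -gh mulKmx ?SL_unit.
by rewrite !mxE.
Qed.

(** Since det(g c, v) = det(c, g^-1 v) when det g = 1, the covector half of [F] transforms in the
    same way as the vector half, through g^-1 on C^2. *)
Lemma SL2_act_Fmx_inv g A : SL g -> SL2_act g (Fmx_inv A) = Fmx_inv (A *m invmx g).
Proof.
move=> g1; pose h := invmx g; have hE := invmx_SL2 g1; rewrite /SL2_act -/h in hE *.
clearbody h; congr (_, _, _, _); apply/matrixP => i j.
- rewrite (ord1 j); move: i; apply: ord2P;
    by rewrite ?mxE ?sum_ord2 ?mxE /= ?sum_ord2 ?hE; ring.
- move: i; apply: ord3P; by rewrite ?mxE ?sum_ord2 ?mxE /= ?sum_ord2; ring.
- by rewrite ?mxE ?sum_ord2 ?mxE; ring.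
- move: i j; apply: ord2P; apply: ord3P;
    by rewrite ?mxE ?sum_ord2 ?mxE /= ?sum_ord2 ?hE; ring.
Qed.

Lemma Fmx_act g x : SL g -> Fmx (SL2_act g x) = Fmx x *m invmx g.
Proof. by move=> g1; rewrite -{1}(FmxK x) SL2_act_Fmx_inv // Fmx_invK. Qed.

Lemma minorsM g A : minors (A *m g) = \det g *: minors A.
Proof.
by apply/matrixP => i j; rewrite !mxE !sum_ord2 det_mx22; ring.
Qed.

Lemma mulmx_J8 (M : 'M[K]_8) i j : (M *m J8 K) i j = M i (rev_ord j).
Proof.
rewrite mxE (bigD1 (rev_ord j)) //= [J8 K _ _]mxE eqxx mulr1 big1 ?addr0 // => k kj.
by rewrite [J8 K _ _]mxE (negbTE kj) mulr0.
Qed.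

Lemma wedge_cols A : wedge (col 0 A) (col 1 A) = - (minors A *m J8 K).
Proof.
apply/matrixP => i j; rewrite wedge_entry [RHS]mxE mulmx_J8 !mxE; ring.
Qed.

Lemma col_Fmx x j : col j (Fmx x) = F x (delta_mx j 0).
Proof. by apply/colP => i; rewrite [LHS]mxE [LHS]mxE. Qed.

Lemma wedge_minors x : wedge (F x (delta_mx 0 0)) (F x (delta_mx 1 0)) =
  - (minors (Fmx x) *m J8 K).
Proof. by rewrite -!col_Fmx wedge_cols. Qed.

Lemma minors_wedge x : minors (Fmx x) =
  - (wedge (F x (delta_mx 0 0)) (F x (delta_mx 1 0)) *m J8 K).
Proof. by rewrite wedge_minors mulNmx opprK -mulmxA J8_invol mulmx1. Qed.

End FmxIso.

(** * The isomorphism *)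

Section Characters.
Variables (K : fieldType) (T : Type) (A : (T -> K) -> Prop).
Hypothesis A_const : forall c, A (fun=> c).
Hypothesis A_add : forall f g, A f -> A g -> A (fun t => f t + g t).
Hypothesis A_mul : forall f g, A f -> A g -> A (fun t => f t * g t).

Lemma character_meval (chi : {f | A f} -> K) N (g : 'I_N -> T -> K)
    (Ag : forall i, A (g i)) (q : {mpoly K[N]}) (h : {f | A f}) :
  is_character chi -> (forall t, sval h t = q.@[fun i => g i t]) ->
  chi h = q.@[fun i => chi (exist _ (g i) (Ag i))].
Proof.
move=> [chiD chiM chiC].
have A_meval p : A (fun t => p.@[fun i => g i t]).
  elim/mpoly_ring_ind: p => [c|i|p1 p2 A1 A2|p1 p2 A1 A2].
  - by rewrite (_ : (fun _ => _) = fun=> c) //; apply: funext => t; rewrite mevalC.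
  - by rewrite (_ : (fun _ => _) = g i) //; apply: funext => t; rewrite mevalXU.
  - rewrite (_ : (fun _ => _) = fun t => p1.@[g^~ t] + p2.@[g^~ t]); first exact: A_add.
    by apply: funext => t; rewrite mevalD.
  - rewrite (_ : (fun _ => _) = fun t => p1.@[g^~ t] * p2.@[g^~ t]); first exact: A_mul.
    by apply: funext => t; rewrite mevalM.
elim/mpoly_ring_ind: q h => [c|i|p1 p2 IH1 IH2|p1 p2 IH1 IH2] h hE.
- by rewrite mevalC; apply: chiC => t; rewrite hE mevalC.
(* [h] and [g i] agree only pointwise; additivity with the zero function identifies their values
   under [chi]. *)
- rewrite mevalXU (chiD (exist _ _ (Ag i)) (exist _ _ (A_const 0))).
    by rewrite (chiC 0 (exist _ _ (A_const 0))) ?addr0.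
  by move=> t; rewrite hE mevalXU /= addr0.
- rewrite mevalD -(IH1 (exist _ _ (A_meval p1))) // -(IH2 (exist _ _ (A_meval p2))) //.
  by apply: chiD => t; rewrite hE mevalD.
- rewrite mevalM -(IH1 (exist _ _ (A_meval p1))) // -(IH2 (exist _ _ (A_meval p2))) //.
  by apply: chiM => t; rewrite hE mevalM.
Qed.

End Characters.

Lemma sval_inj (T : Type) (P : T -> Prop) : injective (@sval T P).
Proof.
move=> [x p] [y q] /= xy; case: y / xy q => q.
by congr exist; exact: Prop_irrelevance.
Qed.

Section Isomorphism.
Variable K : numFieldType.
Implicit Types (P : 'M[K]_8 -> K).
Local Notation invariantN := (invariant_function (S := @Nset K) (@SL K 2) (@SL2_act K)).

Definition Wmx (x : TstarV K) := wedge (F x (delta_mx 0 0)) (F x (delta_mx 1 0)).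

Lemma Wmx_act g x : SL g -> Wmx (SL2_act g x) = Wmx x.
Proof.
move=> g1; have := SL_inv g1; rewrite /Wmx !wedge_minors Fmx_act // minorsM /SL => ->.
by rewrite scale1r.
Qed.

Lemma polynomial_function_mxvec (P : 'M[K]_8 -> K) : polynomial_function P ->
  exists q : {mpoly K[8 * 8]}, forall Y, P Y = q.@[fun k => mxvec Y 0 k].
Proof.
apply: (polynomial_function_coords (b := fun k => vec_mx (delta_mx 0 k))) => Y.
apply: (can_inj mxvecK); rewrite linear_sum /= [LHS]row_sum_delta.
by apply: eq_bigr => k _; rewrite linearZ /= vec_mxK.
Qed.

Lemma Wmx_polynomial i j : polynomial_function (fun x : TstarV K => Wmx x i j).
Proof.
have pF k l : polynomial_function (fun x : TstarV K => Fmx x k l).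
  exact: (polynomial_function_comp (@Fmx K) (polynomial_function_entry K k l)).
have := polynomial_functionB
  (polynomial_functionM (pF i 1) (pF (rev_ord j) 0))
  (polynomial_functionM (pF i 0) (pF (rev_ord j) 1)).
apply: polynomial_function_ext => x.
by rewrite /Wmx wedge_entry -!col_Fmx ![col _ _ _ _]mxE.
Qed.

Lemma Wmx_invariant P : polynomial_function P ->
  invariantN (fun x : Nvar K => P (Wmx (sval x))).
Proof.
move=> /polynomial_function_mxvec [q PE]; split; last first.
  by move=> g x y SLg yE; rewrite yE Wmx_act.
exists (fun x => P (Wmx x)) => //.
have pW k : polynomial_function (fun x : TstarV K => mxvec (Wmx x) 0 k).
  case/mxvec_indexP: k => i j.
  by apply: polynomial_function_ext (Wmx_polynomial i j) => x; rewrite mxvecE.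
by apply: polynomial_function_ext (meval_polynomial_function q pW) => x; rewrite PE.
Qed.

(** In the matrix coordinates N is a cone stable under right multiplication by SL_2, so the
    description of invariants on cones applies. *)
Lemma invariant_Wmx (f : Nvar K -> K) : invariantN f ->
  exists2 P : 'M[K]_8 -> K, polynomial_function P & forall x, f x = P (Wmx (sval x)).
Proof.
move=> [[p pp fE] finv].
have [q qE] : exists q : {mpoly K[8 + 8]}, forall A, p (Fmx_inv A) = q.@[coords A].
  pose b (k : 'I_(8 + 8)) : 'M[K]_(8, 2) :=
    match split k with inl i => delta_mx i 0 | inr i => delta_mx i 1 end.
  apply: (polynomial_function_coords (b := b)).
    move=> A; rewrite big_split_ord /= [LHS]matrix_sum_delta -big_split /=.
    apply: eq_bigr => i _; rewrite sum_ord2 /coords /b.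
    by rewrite (unsplitK (inl i : 'I_8 + 'I_8)) (unsplitK (inr i : 'I_8 + 'I_8)).
  exact: (polynomial_function_comp (@Fmx_inv K)).
have NA (A : 'M[K]_(8, 2)) : isotropic A -> Nset (Fmx_inv A).
  by move=> h; apply/Nset_isotropic; rewrite Fmx_invK.
have [|P0 P0p P0E] := SL2_invariants (@isotropicZ K) (@isotropicM K) (f := q).
  move=> g A SLg iA; rewrite -!qE.
  have iAg := isotropicM SLg iA.
  (* The quiver action is right multiplication by the inverse, so invariance is used for g^-1. *)
  have := finv (invmx g) (exist _ _ (NA _ iA)) (exist _ _ (NA _ iAg)) (SL_inv SLg).
  by rewrite !fE /= SL2_act_Fmx_inv ?invmxK; [apply|exact: SL_inv].
(* The minors are recovered from the wedge by multiplying by - J. *)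
exists (fun Y : 'M[K]_8 => P0 (mulmxr (- J8 K) Y)).
  exact: (polynomial_function_comp (mulmxr (- J8 K))).
move=> x; rewrite fE -{1}(FmxK (sval x)) qE P0E; last by apply/Nset_isotropic; case: x.
by rewrite /= mulmxN minors_wedge.
Qed.

Lemma Wmx_isotropic x : Nset x -> isotropic_wedge (Wmx x).
Proof.
move=> /Nset_isotropic h; have g i j : form8 (F x (delta_mx i 0)) (F x (delta_mx j 0)) = 0.
  by rewrite -!col_Fmx -gram_form8 h mxE.
by exists (F x (delta_mx 0 0)), (F x (delta_mx 1 0)).
Qed.

Lemma Wmx_surjective Y : isotropic_wedge Y -> exists x : Nvar K, Wmx (sval x) = Y.
Proof.
move=> [u [v [uu vv uv ->]]].
pose A : 'M[K]_(8, 2) := \matrix_(i, j) (if j == 0 then u i 0 else v i 0).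
have c0 : col 0 A = u by apply/colP => i; rewrite !mxE.
have c1 : col 1 A = v by apply/colP => i; rewrite !mxE.
have NA : Nset (Fmx_inv A).
  apply/Nset_isotropic; rewrite Fmx_invK; apply/matrixP; apply: ord2P; apply: ord2P;
    by rewrite gram_form8 ?c0 ?c1 mxE // form8C.
exists (exist _ _ NA); rewrite /Wmx /= -!col_Fmx Fmx_invK.
by rewrite c0 c1.
Qed.

Lemma is_isomorphism_comp (L : fieldType) (X Y Z : variety L) (phi : X -> Y) (psi : Y -> Z) :
  is_isomorphism phi -> is_isomorphism psi -> is_isomorphism (fun x => psi (phi x)).
Proof.
move=> [m1 [phi' [m1' c1 c1']]] [m2 [psi' [m2' c2 c2']]]; split.
  by move=> f /m2 /m1.
exists (fun z => phi' (psi' z)); split.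
- by move=> f /m1' /m2'.
- by move=> x; rewrite c2 c1.
- by move=> z; rewrite c1' c2'.
Qed.

Lemma invariantN_const c : invariantN (fun=> c).
Proof.
split=> //; exists (fun=> c) => //; exact: polynomial_function_const.
Qed.

Lemma invariantN_add f g : invariantN f -> invariantN g -> invariantN (fun x => f x + g x).
Proof.
move=> [[p pp fE] fi] [[q qp gE] gi]; split.
  exists (fun x => p x + q x); first exact: polynomial_functionD.
  by move=> x; rewrite fE gE.
by move=> h x y SLh yE; rewrite (fi h x y) ?(gi h x y).
Qed.

Lemma invariantN_mul f g : invariantN f -> invariantN g -> invariantN (fun x => f x * g x).
Proof.
move=> [[p pp fE] fi] [[q qp gE] gi]; split.
  exists (fun x => p x * q x); first exact: polynomial_functionM.
  by move=> x; rewrite fE gE.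
by move=> h x y SLh yE; rewrite (fi h x y) ?(gi h x y).
Qed.

Lemma Wmx_entry_invariant k : invariantN (fun x : Nvar K => mxvec (Wmx (sval x)) 0 k).
Proof.
apply: (Wmx_invariant (P := fun Y => mxvec Y 0 k)); case/mxvec_indexP: k => i j.
by apply: polynomial_function_ext (polynomial_function_entry K i j) => Y; rewrite mxvecE.
Qed.

(** The matrix at which [chi] evaluates: the entries of the wedge generate the invariants, so their
    values under [chi] determine it. *)
Definition spec_Wmx (chi : N_mod_SL2 K) : 'M[K]_8 :=
  vec_mx (\row_k sval chi (exist _ _ (Wmx_entry_invariant k))).

Lemma spec_WmxE (chi : N_mod_SL2 K) P (h : {f | invariantN f}) :
  polynomial_function P -> (forall x, sval h x = P (Wmx (sval x))) ->
  sval chi h = P (spec_Wmx chi).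
Proof.
move=> /polynomial_function_mxvec [q PE] hE.
rewrite (character_meval invariantN_const invariantN_add invariantN_mul
  Wmx_entry_invariant (q := q)) => [||x].
- by rewrite PE; apply: meval_eq => k; rewrite vec_mxK mxE.
- exact: svalP chi.
- by rewrite hE PE.
Qed.

Lemma spec_Wmx_class (x : Nvar K) : spec_Wmx (N_class x) = Wmx (sval x).
Proof.
by rewrite -[RHS]mxvecK; congr vec_mx; apply/rowP => k; rewrite mxE.
Qed.

Theorem N_mod_SL2_iso (O : 'M[K]_8 -> Prop) : minimal_nilpotent_orbit O ->
  exists Phi : N_mod_SL2 K -> closed_subvariety (zariski_closure O),
    is_isomorphism Phi /\ forall x : Nvar K, sval (Phi (N_class x)) = Wmx (sval x).
Proof.
move=> /minimal_closureP OE.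
have WO (x : Nvar K) : zariski_closure O (Wmx (sval x)).
  by apply/OE/Wmx_isotropic; case: x.
(* If f vanishes on the orbit, then f composed with the wedge is the zero function on N, and its
   value under [chi] is f at the matrix of [chi]. *)
have PhiO chi : zariski_closure O (spec_Wmx chi).
  move=> f fp f0.
  rewrite -(@spec_WmxE chi f (exist _ _ (Wmx_invariant fp))) //.
  have [_ _ chiC] := svalP chi; apply: chiC => x /=.
  exact: WO.
pose Phi chi : closed_subvariety (zariski_closure O) := exist _ _ (PhiO chi).
(* The section is an arbitrary choice of points. The inverse is still a morphism, because every
   invariant on N is a polynomial in the wedge, whose value at the chosen point is prescribed. *)
have /choice [s sE] (Y : closed_subvariety (zariski_closure O)) :
    exists x : Nvar K, Wmx (sval x) = sval Y.
  by apply: Wmx_surjective; apply/OE; case: Y.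
exists Phi; split; last by move=> x; exact: spec_Wmx_class.
split.
  move=> f [p pp fE]; exists (exist _ _ (Wmx_invariant pp)) => chi.
  by rewrite fE /= -(@spec_WmxE chi p (exist _ _ (Wmx_invariant pp))).
exists (fun Y => N_class (s Y)); split.
- move=> f [[a ai] fE]; have [P Pp aE] := invariant_Wmx ai.
  by exists P => // Y; rewrite fE /= aE sE.
- move=> chi; apply: sval_inj; apply: funext => -[a ai].
  have [P Pp aE] := invariant_Wmx ai.
  by rewrite (spec_WmxE chi Pp) //= aE sE.
- by move=> Y; apply: sval_inj; rewrite /= spec_Wmx_class sE.
Qed.

End Isomorphism.

Theorem corollary3p8 (R : realType) (Omin : 'M[R[i]]_8 -> Prop)
    (hOmin : minimal_nilpotent_orbit Omin) :
  exists Phi : N_mod_SL2 R[i] -> closed_subvariety (zariski_closure Omin),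
    [/\ is_isomorphism Phi,
        forall x : Nvar R[i],
          sval (Phi (N_class x)) =
            wedge (F (sval x) (delta_mx 0 0)) (F (sval x) (delta_mx 1 0)) &
        forall j : TstarSL3U_closure R[i] -> N_mod_SL2 R[i],
          DKS_identification j -> is_isomorphism (fun t => Phi (j t))].
Proof.
have [Phi [Phi_iso PhiE]] := @N_mod_SL2_iso R[i] Omin hOmin.
exists Phi; split=> // j [j_iso _].
exact: is_isomorphism_comp j_iso Phi_iso.
Qed.
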